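(* Let $W=\max_{i\in[M]}|G_i|/\min_{i\in[M]}|G_i|$. There exist absolute constants $C,c_1,c_2,c_3,c_4>0$ such that if $p\ge c_1n\log(n+W)$ and $\log(M)\le c_2\min_{i\in[M]}|G_i|$, then there is an event of probability at least $1-Me^{-c_3n}$ on which $$\|\hat h-h^*\|_2^2\le C\Big(W\frac{\|\xi\|_2^2}{n}+\|h^*\|_{\mathrm{GL}}^2\,\frac{\max_{i\in[M]}|G_i|}{n}\Big).$$ Moreover, if $s\max_{i\in[M]}|G_i|\le c_4n$, then on the same event $$\|\hat h-h^*\|_2^2\le C\,W\,\frac{\|\xi\|_2^2}{n}.$$
   Context: $[M]=\{1,\dots,M\}$, and $G_1,\dots,G_M$ is a prescribed partition of $\{1,\dots,p\}$ into $M$ disjoint (non-empty) groups. For $h\in\mathbb R^p$ and $S\subset\{1,\dots,p\}$, $h_S$ is the projection of $h$ onto the span of the canonical basis vectors $e_i$, $i\in S$. The group Lasso norm is $\|h\|_{\mathrm{GL}}=\sum_{i=1}^M\|h_{G_i}\|_2$. Data: $Y_i=\langle X_i,h^*\rangle+\xi_i$, $i=1,\dots,n$, where $X_1,\dots,X_n$ are i.i.d. $\mathcal N(0,I_p)$, $h^*\in\mathbb R^p$ is $s$-group sparse with respect to the partition, i.e. there is $I\subset[M]$ with $|I|\le s$ and $\sum_{i=1}^M\|h^*_{G_i}\|_2=\sum_{i\in I}\|h^*_{G_i}\|_2$, and $\xi=(\xi_1,\dots,\xi_n)$ is an arbitrary error vector (deterministic, random, or depending adversarially on the $X_i$ and $h^*$).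 The estimator $\hat h$ is a minimizer of $\|h\|_{\mathrm{GL}}$ over $h\in\mathbb R^p$ subject to $\langle X_i,h\rangle=Y_i$, $i=1,\dots,n$. *)

(* Defs.v *)
From HB Require Import structures.
From mathcomp Require Import all_boot all_order all_algebra.
From mathcomp Require Import all_classical all_reals all_analysis.
Set Implicit Arguments.
Unset Strict Implicit.
Unset Printing Implicit Defensive.
Import Order.TTheory GRing.Theory Num.Theory.
Local Open Scope ring_scope.

(* Deterministic vectors
   of R^p are row vectors ['rV[R]_p]; random vectors take values in
   [p.-tuple R], which the library equips with the product (Borel)
   sigma-algebra. *)

Section Norms.
Context {R : realType} {p M : nat}.

(* The library norm on ['rV[R]_p] is the sup norm, hence this definition. *)
Definition l2norm (k : nat) (h : 'rV[R]_k) : R :=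
  Num.sqrt (\sum_(j < k) h ord0 j ^+ 2).

Definition proj_on (S : {set 'I_p}) (h : 'rV[R]_p) : 'rV[R]_p :=
  \row_(j < p) (if j \in S then h ord0 j else 0).

Definition gl_norm (G : 'I_M -> {set 'I_p}) (h : 'rV[R]_p) : R :=
  \sum_(i < M) l2norm (proj_on (G i) h).

Definition group_sparse (G : 'I_M -> {set 'I_p}) (s : nat) (h : 'rV[R]_p)
    : Prop :=
  exists2 I : {set 'I_M}, (#|I| <= s)%N
    & gl_norm G h = \sum_(i in I) l2norm (proj_on (G i) h).

Definition inner (x : p.-tuple R) (h : 'rV[R]_p) : R :=
  \sum_(j < p) tnth x j * h ord0 j.

Definition interpolates (n : nat) (x : 'I_n -> p.-tuple R) (y : 'rV[R]_n)
    (h : 'rV[R]_p) : Prop :=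
  forall i : 'I_n, inner (x i) h = y ord0 i.

Definition min_gl_interpolator (G : 'I_M -> {set 'I_p}) (n : nat)
    (x : 'I_n -> p.-tuple R) (y : 'rV[R]_n) (h : 'rV[R]_p) : Prop :=
  interpolates x y h /\
  forall h' : 'rV[R]_p, interpolates x y h' -> gl_norm G h <= gl_norm G h'.

End Norms.

Section Groups.
Context {p M : nat}.

Definition group_partition (G : 'I_M -> {set 'I_p}) : Prop :=
  [/\ forall i : 'I_M, (0 < #|G i|)%N,
      forall i j : 'I_M, i != j -> [disjoint G i & G j]
    & forall k : 'I_p, exists i : 'I_M, k \in G i].

Definition max_group (G : 'I_M -> {set 'I_p}) : nat :=
  \max_(i < M) #|G i|.

(* The neutral value [p] is harmless for [0 < M], since [#|G i| <= p]. *)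
Definition min_group (G : 'I_M -> {set 'I_p}) : nat :=
  \big[minn/p]_(i < M) #|G i|.

Definition group_ratio (R : realType) (G : 'I_M -> {set 'I_p}) : R :=
  (max_group G)%:R / (min_group G)%:R.

End Groups.

Section Probability.
Local Open Scope classical_set_scope.
Context {R : realType} {d : measure_display} {T : measurableType d}.
Variable P : probability T R.

Definition mutually_independent (d' : measure_display)
    (E : measurableType d') (n : nat) (X : 'I_n -> {RV P >-> E}) : Prop :=
  forall (J : {set 'I_n}) (B : 'I_n -> set E),
    (forall i, measurable (B i)) ->
    P [set w | forall i, i \in J -> B i (X i w)] =
    (\prod_(i in J) P (X i @^-1` B i))%E.

(* X ~ N(0, I_p): the law of X is the p-fold product of N(0, 1); product
   measures are determined by their values on measurable boxes. *)
Definition std_gaussian (p : nat) (X : {RV P >-> p.-tuple R}) : Prop :=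
  forall B : 'I_p -> set R, (forall j, measurable (B j)) ->
    distribution P X [set x | forall j, B j (tnth x j)] =
    (\prod_(j < p) normal_prob 0 1 (B j))%E.

End Probability.

(* Main.v *)
(* A minimizer is controlled by two deterministic properties of the n x p design
   matrix X, valid off an event of probability at most exp(-n).

   (i) X^T has smallest singular value at least a multiple of sqrt p.  The
   least-norm solution e = X^T (X X^T)^-1 xi of X e = xi then satisfies
   |e|_GL <= sqrt M |e|_2 <~ sqrt (M / p) |xi|_2 <= |xi|_2 / sqrt (min |G_i|),
   and minimality gives |hhat|_GL <= |h*|_GL + |e|_GL.

   (ii) |X h|_2 >= kappa sqrt n |h|_2 - Lambda sqrt (max |G_i|) |h|_GL for all h.
   This follows from a two-sided bound for |X u|_2 on vectors u supported on k
   groups, k ~ n / max |G_i|, by peeling off the k largest groups repeatedly.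

   Both come from a union bound over integer points: a lattice approximates every
   vector of a coordinate subspace of dimension d up to a small relative error
   with only exp(O(d)) points, so small deviation estimates of rate exp(-4 m) for
   chi-square variables with m degrees of freedom suffice.  These estimates are
   Chernoff bounds for the Laplace transform of |X h|^2 and |X^T v|^2, computed by
   integrating out one Gaussian variable at a time:
   E exp(-l (a + h g)^2) = (1 + 2 l h^2)^(-1/2) exp(-(l / (1 + 2 l h^2)) a^2)
   has the same shape in a, so the computation iterates without any rotation
   invariance. *)

Require Import Defs.
From HB Require Import structures.
From mathcomp Require Import all_boot all_order all_algebra.
From mathcomp Require Import all_classical all_reals all_analysis.
From mathcomp Require Import measurable_realfun.
From mathcomp Require Import ring lra.
Set Implicit Arguments.
Unset Strict Implicit.
Unset Printing Implicit Defensive.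
Import Order.TTheory GRing.Theory Num.Theory.
Local Open Scope ring_scope.

(** * Product measures on tuples *)

Section tuple_measures.
Local Open Scope classical_set_scope.
Context {R : realType} {d : measure_display} {E : measurableType d}.

Lemma tuple_boxE n (B : 'I_n -> set E) :
  [set t : n.-tuple E | forall i, B i (tnth t i)] =
  \big[setI/setT]_(i < n) ((fun t : n.-tuple E => tnth t i) @^-1` B i).
Proof.
rewrite -bigcap_seq; apply/seteqP; split=> t /= Bt i; first by move=> _; exact: Bt.
by apply: Bt; exact: mem_index_enum.
Qed.

Lemma measurable_tuple_box n (B : 'I_n -> set E) :
  (forall i, measurable (B i)) ->
  measurable [set t : n.-tuple E | forall i, B i (tnth t i)].
Proof.
move=> mB; rewrite tuple_boxE; apply: bigsetI_measurable => i _.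
by rewrite -[X in measurable X]setTI; exact: measurable_tnth.
Qed.

(** Measurable boxes are closed under intersection, contain the whole space and generate the product
    sigma-algebra, so a finite measure is determined by its values on them. *)
Lemma tuple_measure_unique n (m1 : probability (n.-tuple E) R)
    (m2 : {measure set (n.-tuple E) -> \bar R}) :
  (forall B : 'I_n -> set E, (forall i, measurable (B i)) ->
     m1 [set t | forall i, B i (tnth t i)] =
     m2 [set t | forall i, B i (tnth t i)]) ->
  forall A, measurable A -> m1 A = m2 A.
Proof.
move=> m12.
pose G := [set A : set (n.-tuple E) | exists2 B : 'I_n -> set E,
  (forall i, measurable (B i)) & A = [set t | forall i, B i (tnth t i)]].
have GT : G setT.
  by exists (fun=> setT) => //; apply/seteqP; split.
apply: (measure_unique G (fun=> setT)) => //.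
- apply/seteqP; split.
    apply: smallest_sub; first exact: smallest_sigma_algebra.
    move=> A; rewrite /= -bigcup_seq => -[i /= _ [B mB <-]].
    apply: sub_sigma_algebra; exists (fun j => if j == i then B else setT).
      by move=> j; case: ifP.
    apply/seteqP; split=> t /=.
      by move=> [_ Bt] j; case: eqP => // ->.
    by move=> /(_ i); rewrite eqxx.
  apply: smallest_sub; first exact: sigma_algebra_measurable.
  by move=> _ [B mB ->]; exact: measurable_tuple_box.
- move=> _ _ [B mB ->] [C mC ->]; exists (fun i => B i `&` C i).
    by move=> i; exact: measurableI.
  apply/seteqP; split=> t /=; first by move=> [Bt Ct] i; split.
  by move=> BCt; split=> i; have [] := BCt i.
- by apply/seteqP; split=> // t _; exists 0%N.
- by move=> _ [B mB ->]; exact: m12.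
- by move=> _; rewrite (le_lt_trans (probability_le1 _ _)) ?ltry.
Qed.

(** The [n]-fold power of [mu], specified by its values on boxes; by [tuple_measure_unique] at most
    one [Q] satisfies this. *)
Definition iid (mu : probability E R) n (Q : probability (n.-tuple E) R) :=
  forall B : 'I_n -> set E, (forall i, measurable (B i)) ->
    Q [set t | forall i, B i (tnth t i)] = (\prod_(i < n) mu (B i))%E.

Definition tuple_cons n (z : E * n.-tuple E) : n.+1.-tuple E :=
  [tuple of z.1 :: z.2].

Lemma measurable_tuple_cons n : measurable_fun setT (@tuple_cons n).
Proof. exact: measurable_cons. Qed.

HB.instance Definition _ n :=
  isMeasurableFun.Build _ _ _ _ (@tuple_cons n) (@measurable_tuple_cons n).

Definition tuple_behead n (t : n.+1.-tuple E) : n.-tuple E :=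
  [tuple of behead t].

Lemma tnth_tuple_behead n (t : n.+1.-tuple E) i :
  tnth (tuple_behead t) i = tnth t (lift ord0 i).
Proof. by rewrite {2}(tuple_eta t) tnthS. Qed.

HB.instance Definition _ n :=
  isMeasurableFun.Build _ _ _ _ (@tuple_behead n) (@measurable_behead _ _ n).

Variable mu : probability E R.

(** A box for the tail is a box for the full tuple whose first side is the whole space, of mass
    one. *)
Lemma iid_behead n (Q : probability (n.+1.-tuple E) R) :
  iid mu Q -> iid mu (distribution Q (@tuple_behead n)).
Proof.
move=> iQ B mB.
have := iQ (fun i => if unlift ord0 i is Some j then B j else setT).
rewrite big_ord_recl unlift_none probability_setT mul1e.
under eq_bigr do rewrite liftK.
move=> <-; last by move=> i; case: unliftP.
rewrite /distribution/= /pushforward; congr (Q _).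
apply/seteqP; split=> t /= Bt i.
  by case: unliftP => // j ->; rewrite -tnth_tuple_behead.
by rewrite tnth_tuple_behead; have := Bt (lift ord0 i); rewrite liftK.
Qed.

Lemma iid_consE n (Q : probability (n.+1.-tuple E) R) : iid mu Q ->
  forall A, measurable A ->
  Q A = pushforward (mu \x distribution Q (@tuple_behead n))%E
          (@tuple_cons n) A.
Proof.
move=> iQ; apply: (@tuple_measure_unique _ Q (pushforward
    (mu \x distribution Q (@tuple_behead n))%E (@tuple_cons n))).
move=> B mB; rewrite iQ//= /pushforward.
transitivity ((mu \x distribution Q (@tuple_behead n))%E (B ord0 `*`
    [set t | forall i, B (lift ord0 i) (tnth t i)])).
  have mB' := measurable_tuple_box (fun i => mB (lift ord0 i)).
  by rewrite product_measure1E// big_ord_recl; congr *%E;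
      apply/esym/(iid_behead iQ).
congr (product_measure1 _ _ _).
apply/seteqP; split=> -[x t] /= Bt.
  by move=> i; case: (unliftP ord0 i) => [j|] ->; rewrite ?tnthS ?tnth0; case: Bt.
by split=> [|i]; [have := Bt ord0|have := Bt (lift ord0 i); rewrite tnthS].
Qed.

(** Tonelli's theorem for the factorization of [Q] in [iid_consE]. Since the law of the tail is
    again [iid], this is the step that the inductions on [n] below repeat. *)
Lemma iid_integral n (Q : probability (n.+1.-tuple E) R)
    (f : n.+1.-tuple E -> R) :
  iid mu Q -> measurable_fun [set: n.+1.-tuple E] f -> (forall t, 0 <= f t) ->
  (\int[Q]_t (f t)%:E =
   \int[mu]_x \int[distribution Q (@tuple_behead n)]_t
     (f (tuple_cons (x, t)))%:E)%E.
Proof.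
move=> iQ mf f0.
have mF : measurable_fun [set: n.+1.-tuple E] (fun t => (f t)%:E).
  exact/measurable_EFinP.
rewrite -[RHS](fubini_tonelli1 (fun z => (f (tuple_cons z))%:E)).
- rewrite -[RHS](@ge0_integral_pushforward _ _ _ _ R _
      (@measurable_tuple_cons n) _ setT (fun t => (f t)%:E))//.
  + by apply: eq_measure_integral => A mA _; exact: iid_consE.
  + by move=> t _; rewrite lee_fin.
- exact: (measurableT_comp mF (@measurable_tuple_cons n)).
- by move=> z; rewrite lee_fin.
Qed.

Lemma integral_tuple0 (Q : probability (0.-tuple E) R) (f : 0.-tuple E -> R) :
  (\int[Q]_t (f t)%:E = (f [tuple])%:E)%E.
Proof.
rewrite (eq_integral (cst (f [tuple])%:E)); last first.
  by move=> t _; rewrite (tuple0 t).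
by rewrite integral_cst//= probability_setT mule1.
Qed.

Lemma iid_integral_prod n (Q : probability (n.-tuple E) R)
    (f : 'I_n -> E -> R) (c : 'I_n -> R) :
  iid mu Q -> (forall i, measurable_fun setT (f i)) ->
  (forall i x, 0 <= f i x) ->
  (forall i, \int[mu]_x (f i x)%:E = (c i)%:E)%E ->
  (\int[Q]_t (\prod_(i < n) f i (tnth t i))%:E = (\prod_(i < n) c i)%:E)%E.
Proof.
elim: n Q f c => [|n IH] Q f c iQ mf f0 fc.
  by rewrite integral_tuple0 !big_ord0.
rewrite (iid_integral iQ); last 2 first.
- apply: measurable_prod => i _; apply: measurableT_comp => //.
  exact: measurable_tnth.
- by move=> t; exact: prodr_ge0.
have inner x : (\int[distribution Q (@tuple_behead n)]_t
    (\prod_(i < n.+1) f i (tnth (tuple_cons (x, t)) i))%:E =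
    (\prod_(i < n) c (lift ord0 i))%:E * (f ord0 x)%:E)%E.
  rewrite -(IH _ (fun i => f (lift ord0 i)) _ (iid_behead iQ))//.
  rewrite -ge0_integralZr//=.
  - apply: eq_integral => t _; rewrite -EFinM big_ord_recl mulrC.
    by congr (_ * _)%:E; apply: eq_bigr => i _; rewrite tnthS.
  - apply/measurable_EFinP; apply: measurable_prod => i _.
    by apply: measurableT_comp => //; exact: measurable_tnth.
  - by move=> t _; rewrite lee_fin; exact: prodr_ge0.
  - by rewrite lee_fin.
under eq_integral do rewrite inner.
rewrite ge0_integralZl//=.
- by rewrite fc -EFinM big_ord_recl mulrC.
- exact/measurable_EFinP.
- by move=> x _; rewrite lee_fin.
- rewrite lee_fin; apply: prodr_ge0 => i _; rewrite -lee_fin -fc.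
  by apply: integral_ge0 => x _; rewrite lee_fin.
Qed.

End tuple_measures.

(** * Gaussian Laplace transforms *)

Section gaussian_laplace.
Local Open Scope classical_set_scope.
Context {R : realType}.
Implicit Types l a h : R.

(** The Radon-Nikodym derivative of the normal law and the explicit density have the same integral
    over every measurable set, hence agree almost everywhere. *)
Lemma ge0_integral_normal_prob (m s : R) (f : R -> R) :
  measurable_fun setT f -> (forall x, 0 <= f x) ->
  (\int[normal_prob m s]_x (f x)%:E =
   \int[lebesgue_measure]_x (f x * normal_pdf m s x)%:E)%E.
Proof.
move=> mf f0.
have nu_mu := normal_prob_dominates m s.
have mpdf : measurable_fun setT (EFin \o normal_pdf m s).
  by apply/measurable_EFinP; exact: measurable_normal_pdf.
have mF : measurable_fun setT (EFin \o f) by exact/measurable_EFinP.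
have F0 x : (0 <= (f x)%:E)%E by rewrite lee_fin.
rewrite -[LHS](Radon_Nikodym_SigmaFinite.change_of_variables nu_mu F0)//.
set g := Radon_Nikodym_SigmaFinite.f _ _.
have ig : lebesgue_measure.-integrable setT g.
  exact: Radon_Nikodym_SigmaFinite.f_integrable.
apply: ge0_ae_eq_integral => //.
- apply: emeasurable_funM; first exact/measurable_EFinP.
  exact: measurable_int ig.
- apply/measurable_EFinP/measurable_funM => //.
  exact: measurable_normal_pdf.
- move=> x _; apply: mule_ge0; first by rewrite lee_fin.
  exact: Radon_Nikodym_SigmaFinite.f_ge0.
- by move=> x _; rewrite lee_fin mulr_ge0// normal_pdf_ge0.
have : ae_eq lebesgue_measure setT g (EFin \o normal_pdf m s).
  apply: integral_ae_eq => // A _ mA.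
  by rewrite -Radon_Nikodym_SigmaFinite.f_integral.
by apply: filterS => x gx /gx /= ->; rewrite EFinM.
Qed.

Lemma measurable_expR_quad l a h :
  measurable_fun setT (fun x : R => expR (- l * (a + h * x) ^+ 2)).
Proof.
apply: measurableT_comp => //; apply: measurable_funM => //.
apply: measurable_funX; apply: measurable_funD => //.
Qed.

(** Completing the square turns the integrand into a constant times the normal density with mean [m]
    and variance [D^-1]. Negative [l] is allowed as long as [D] stays positive; the upper tail needs
    this. *)
Lemma integral_normal_expR_quad l a h : 0 < 1 + 2 * l * h ^+ 2 ->
  (\int[normal_prob 0 1]_x (expR (- l * (a + h * x) ^+ 2))%:E =
   ((Num.sqrt (1 + 2 * l * h ^+ 2))^-1 *
    expR (- (l / (1 + 2 * l * h ^+ 2)) * a ^+ 2))%:E)%E.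
Proof.
set D := 1 + _ => D0.
have sD0 : 0 < Num.sqrt D by rewrite sqrtr_gt0.
rewrite ge0_integral_normal_prob//; last exact: measurable_expR_quad.
pose s := (Num.sqrt D)^-1; pose m := - (2 * l * a * h / D).
have s0 : s != 0 by rewrite invr_eq0 gt_eqF.
have ss : s ^+ 2 = D^-1 by rewrite exprVn sqr_sqrtr ?ltW.
pose c := (Num.sqrt D)^-1 * expR (- (l / D) * a ^+ 2).
transitivity (\int[lebesgue_measure]_x (c%:E * (normal_pdf m s x)%:E))%E.
  apply: eq_integral => x _; rewrite -EFinM; congr (_%:E).
  rewrite !normal_pdfE ?oner_neq0// /normal_peak /normal_fun ss.
  have -> : Num.sqrt (D^-1 * pi *+ 2) =
      (Num.sqrt D)^-1 * Num.sqrt (1 ^+ 2 * pi *+ 2).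
    rewrite -mulrnAr sqrtrM ?invr_ge0 ?ltW// sqrtrV ?ltW//.
    by rewrite expr1n mul1r.
  rewrite invfM invrK /c subr0.
  set P := (Num.sqrt (_ * pi *+ 2))^-1.
  transitivity (P * (expR (- l * (a + h * x) ^+ 2) *
     expR (- x ^+ 2 / (1 ^+ 2 *+ 2)))); first by ring.
  transitivity (P * (expR (- (l / D) * a ^+ 2) *
     expR (- (x - m) ^+ 2 / (D^-1 *+ 2)))); last first.
    by field; rewrite gt_eqF.
  congr (_ * _); rewrite -!expRD; congr expR.
  rewrite /m -mulr_natr expr1n mul1r.
  have DE : D = 1 + 2 * l * h ^+ 2 by [].
  have D1 : D != 0 by rewrite gt_eqF.
  by rewrite -mulr_natr; field: DE.
rewrite ge0_integralZl//=.
- by rewrite integral_normal_pdf mule1.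
- by apply/measurable_EFinP; exact: measurable_normal_pdf.
- by move=> x _; rewrite lee_fin normal_pdf_ge0.
- by rewrite lee_fin mulr_ge0 ?expR_ge0// invr_ge0 ltW.
Qed.

Let idTR : measurableTypeR R -> R := idfun.

#[local] HB.instance Definition _ :=
  @isMeasurableFun.Build _ _ _ _ idTR (@measurable_id _ _ setT).

(* [normal_prob] lives on [measurableTypeR R], whose display is not that of the
   canonical Borel structure of [R] used by [p.-tuple R]. *)
Definition gauss : probability R R :=
  distribution (normal_prob 0 1 : probability (measurableTypeR R) R) idTR.

Lemma integral_gauss_expR_quad l a h : 0 < 1 + 2 * l * h ^+ 2 ->
  (\int[gauss]_x (expR (- l * (a + h * x) ^+ 2))%:E =
   ((Num.sqrt (1 + 2 * l * h ^+ 2))^-1 *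
    expR (- (l / (1 + 2 * l * h ^+ 2)) * a ^+ 2))%:E)%E.
Proof.
move=> D0; rewrite -integral_normal_expR_quad//.
rewrite (@ge0_integral_distribution _ _ _ _ _ _ idTR
  (fun x => (expR (- l * (a + h * x) ^+ 2))%:E))//.
  by apply/measurable_EFinP; exact: measurable_expR_quad.
Qed.

End gaussian_laplace.
Arguments gauss R : clear implicits.

Section iid_laplace.
Local Open Scope classical_set_scope.
Context {R : realType}.
Implicit Types l a : R.

Let nu : probability R R := gauss R.

Lemma measurable_tuple_sum n (h : 'I_n -> R) :
  measurable_fun [set: n.-tuple R] (fun t => \sum_(i < n) tnth t i * h i).
Proof.
apply: measurable_sum => i; apply: measurable_funM => //.
exact: measurable_tnth.
Qed.

Lemma measurable_expR_tuple l a n (h : 'I_n -> R) :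
  measurable_fun [set: n.-tuple R]
    (fun t => expR (- l * (a + \sum_(i < n) tnth t i * h i) ^+ 2)).
Proof.
apply: measurableT_comp => //; apply: measurable_funM => //.
apply: measurable_funX; apply: measurable_funD => //.
exact: measurable_tuple_sum.
Qed.

(** Keeps the Laplace transform finite after variables are dropped: for negative [l] fewer terms
    only increase the expression. *)
Let pos_partial l (u v : R) : 0 <= u -> 0 <= v ->
  0 < 1 + 2 * l * (u + v) -> 0 < 1 + 2 * l * v.
Proof.
move=> u0 v0 H; have [l0|l0] := leP 0 l.
  by rewrite ltr_wpDr// mulr_ge0// mulr_ge0.
by apply: lt_le_trans H _; nra.
Qed.

(** The free shift [a] carries the induction: integrating out the tail leaves a one-dimensional
    integral of the same shape, with [l] replaced by [l / D']. *)
Lemma row_laplace l a p (h : 'I_p -> R) (mu : probability (p.-tuple R) R) :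
  iid nu mu -> 0 < 1 + 2 * l * \sum_(j < p) h j ^+ 2 ->
  (\int[mu]_t (expR (- l * (a + \sum_(j < p) tnth t j * h j) ^+ 2))%:E =
   ((Num.sqrt (1 + 2 * l * \sum_(j < p) h j ^+ 2))^-1 *
    expR (- (l / (1 + 2 * l * \sum_(j < p) h j ^+ 2)) * a ^+ 2))%:E)%E.
Proof.
elim: p a h mu => [|p IH] a h mu imu.
  rewrite (@integral_tuple0 _ _ _ mu (fun t => expR (- l * (a + \sum_(j < 0)
      tnth t j * h j) ^+ 2))).
  by rewrite !big_ord0 mulr0 !addr0 sqrtr1 invr1 mulr1 mul1r.
rewrite (iid_integral imu (measurable_expR_tuple _ _ _)); last first.
  by move=> t; exact: expR_ge0.
rewrite big_ord_recl; set S := \sum_(i < p) _ => D0.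
have S0 : 0 <= S by apply: sumr_ge0 => j _; exact: sqr_ge0.
have D'0 : 0 < 1 + 2 * l * S by apply: pos_partial D0 => //; exact: sqr_ge0.
set D := 1 + _ in D0 *; set D' := 1 + _ in D'0.
have D1 : D != 0 by rewrite gt_eqF.
have D'1 : D' != 0 by rewrite gt_eqF.
have inner x : (\int[distribution mu (@tuple_behead _ _ p)]_t
    (expR (- l * (a + \sum_(j < p.+1) tnth (tuple_cons (x, t)) j * h j) ^+ 2))%:E =
    ((Num.sqrt D')^-1)%:E *
    (expR (- (l / D') * (a + h ord0 * x) ^+ 2))%:E)%E.
  rewrite -EFinM -(IH _ _ _ (iid_behead imu))//.
  apply: eq_integral => t _; congr (expR (_ * _ ^+ 2))%:E.
  rewrite big_ord_recl addrA mulrC; congr (_ + _ * _ + _).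
  by apply: eq_bigr => j _; rewrite tnthS.
under eq_integral do rewrite inner.
have sD'0 : 0 < Num.sqrt D' by rewrite sqrtr_gt0.
(* The normalizing factors telescope: [D'] from the tail times [D / D'] from the head gives [D]. *)
have DE : 1 + 2 * (l / D') * h ord0 ^+ 2 = D / D'.
  by rewrite /D /D'; field.
rewrite ge0_integralZl//; last first.
- by apply/measurable_EFinP; exact: measurable_expR_quad.
rewrite integral_gauss_expR_quad DE ?divr_gt0// -EFinM.
rewrite sqrtrM ?(ltW D0)// sqrtrV ?(ltW D'0)// invf_div !mulrA.
congr (_ * expR (_ * _))%:E; last by field; rewrite D1.
by rewrite mulVf ?mul1r// gt_eqF.
Qed.

Lemma coordinates_laplace l (v : R) p (a : 'I_p -> R)
    (mu : probability (p.-tuple R) R) :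
  iid nu mu -> 0 < 1 + 2 * l * v ^+ 2 ->
  (\int[mu]_t (expR (- l * \sum_(j < p) (a j + v * tnth t j) ^+ 2))%:E =
   ((Num.sqrt (1 + 2 * l * v ^+ 2))^-1 ^+ p *
    expR (- (l / (1 + 2 * l * v ^+ 2)) * \sum_(j < p) a j ^+ 2))%:E)%E.
Proof.
move=> imu D0.
under eq_integral do rewrite mulr_sumr expR_sum.
rewrite (iid_integral_prod (f := fun j x => expR (- l * (a j + v * x) ^+ 2))
  (c := fun j => (Num.sqrt (1 + 2 * l * v ^+ 2))^-1 *
    expR (- (l / (1 + 2 * l * v ^+ 2)) * a j ^+ 2)) imu).
- by rewrite big_split/= prodr_const card_ord mulr_sumr expR_sum.
- by move=> j; exact: measurable_expR_quad.
- by move=> j x; exact: expR_ge0.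
- by move=> j; rewrite integral_gauss_expR_quad.
Qed.

Lemma measurable_tnth2 n p (i : 'I_n) (j : 'I_p) :
  measurable_fun [set: n.-tuple (p.-tuple R)] (fun t => tnth (tnth t i) j).
Proof.
apply: (measurableT_comp (@measurable_tnth _ _ p j)).
exact: (@measurable_tnth _ (p.-tuple R) n i).
Qed.

Lemma measurable_expR_columns l n p (a : 'I_p -> R) (v : 'I_n -> R) :
  measurable_fun [set: n.-tuple (p.-tuple R)]
    (fun t => expR (- l * \sum_(j < p)
       (a j + \sum_(i < n) v i * tnth (tnth t i) j) ^+ 2)).
Proof.
apply: measurableT_comp => //; apply: measurable_funM => //.
apply: measurable_sum => j; apply: measurable_funX; apply: measurable_funD => //.
apply: measurable_sum => i; apply: measurable_funM => //.
exact: measurable_tnth2.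
Qed.

(** The induction of [row_laplace], now over the rows and with all [p] coordinates in parallel;
    [coordinates_laplace] integrates out the first row. *)
Lemma columns_laplace l n p (a : 'I_p -> R) (v : 'I_n -> R)
    (mu : probability (p.-tuple R) R)
    (Q : probability (n.-tuple (p.-tuple R)) R) :
  iid nu mu -> iid mu Q -> 0 < 1 + 2 * l * \sum_(i < n) v i ^+ 2 ->
  (\int[Q]_t (expR (- l * \sum_(j < p)
       (a j + \sum_(i < n) v i * tnth (tnth t i) j) ^+ 2))%:E =
   ((Num.sqrt (1 + 2 * l * \sum_(i < n) v i ^+ 2))^-1 ^+ p *
    expR (- (l / (1 + 2 * l * \sum_(i < n) v i ^+ 2)) *
          \sum_(j < p) a j ^+ 2))%:E)%E.
Proof.
move=> imu; elim: n a v Q => [|n IH] a v Q iQ.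
  rewrite (@integral_tuple0 _ _ _ Q (fun t => expR (- l * \sum_(j < p) (a j +
      \sum_(i < 0) v i * tnth (tnth t i) j) ^+ 2))).
  rewrite big_ord0 mulr0 !addr0 sqrtr1 invr1 expr1n mulr1 mul1r => _.
  by congr (expR (_ * _))%:E; apply: eq_bigr => j _; rewrite big_ord0 addr0.
rewrite (iid_integral iQ (measurable_expR_columns _ _ _)); last first.
  by move=> t; exact: expR_ge0.
rewrite big_ord_recl; set S := \sum_(i < n) _ => D0.
have S0 : 0 <= S by apply: sumr_ge0 => j _; exact: sqr_ge0.
have D'0 : 0 < 1 + 2 * l * S by apply: pos_partial D0 => //; exact: sqr_ge0.
set D := 1 + _ in D0 *; set D' := 1 + _ in D'0.
have D1 : D != 0 by rewrite gt_eqF.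
have D'1 : D' != 0 by rewrite gt_eqF.
have inner x : (\int[distribution Q (@tuple_behead _ _ n)]_t
    (expR (- l * \sum_(j < p) (a j +
       \sum_(i < n.+1) v i * tnth (tnth (tuple_cons (x, t)) i) j) ^+ 2))%:E =
    ((Num.sqrt D')^-1 ^+ p)%:E *
    (expR (- (l / D') * \sum_(j < p) (a j + v ord0 * tnth x j) ^+ 2))%:E)%E.
  rewrite -EFinM -(IH _ _ _ (iid_behead iQ))//.
  apply: eq_integral => t _; congr (expR (_ * _))%:E.
  apply: eq_bigr => j _; congr (_ ^+ 2).
  rewrite big_ord_recl addrA; congr (_ + _ * _ + _).
  by apply: eq_bigr => i _; rewrite tnthS.
under eq_integral do rewrite inner.
have sD'0 : 0 < Num.sqrt D' by rewrite sqrtr_gt0.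
have DE : 1 + 2 * (l / D') * v ord0 ^+ 2 = D / D'.
  by rewrite /D /D'; field.
rewrite ge0_integralZl//; last first.
- apply/measurable_EFinP; apply: measurableT_comp => //.
  apply: measurable_funM => //; apply: measurable_sum => j.
  apply: measurable_funX; apply: measurable_funD => //.
  by apply: measurable_funM => //; exact: measurable_tnth.
rewrite coordinates_laplace// DE ?divr_gt0// -EFinM.
rewrite sqrtrM ?(ltW D0)// sqrtrV ?(ltW D'0)// invf_div mulrA -exprMn mulrA.
congr (_ ^+ _ * expR (_ * _))%:E; last by field; rewrite D1.
by rewrite mulVf ?mul1r// gt_eqF.
Qed.

Lemma rows_laplace l n p (h : 'I_p -> R)
    (mu : probability (p.-tuple R) R)
    (Q : probability (n.-tuple (p.-tuple R)) R) :
  iid nu mu -> iid mu Q -> 0 < 1 + 2 * l * \sum_(j < p) h j ^+ 2 ->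
  (\int[Q]_t (expR (- l * \sum_(i < n)
       (\sum_(j < p) tnth (tnth t i) j * h j) ^+ 2))%:E =
   ((Num.sqrt (1 + 2 * l * \sum_(j < p) h j ^+ 2))^-1 ^+ n)%:E)%E.
Proof.
move=> imu iQ D0.
under eq_integral do rewrite mulr_sumr expR_sum.
rewrite (iid_integral_prod
  (f := fun _ (t : p.-tuple R) => expR (- l * (\sum_(j < p) tnth t j * h j) ^+ 2))
  (c := fun=> (Num.sqrt (1 + 2 * l * \sum_(j < p) h j ^+ 2))^-1) iQ).
- by rewrite prodr_const card_ord.
- move=> i; have := measurable_expR_tuple l 0 h.
  by under eq_fun do rewrite add0r.
- by move=> i x; exact: expR_ge0.
- move=> i; have := row_laplace 0 imu D0.
  rewrite expr0n/= mulr0 expR0 mulr1 => <-.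
  by apply: eq_integral => t _; rewrite add0r.
Qed.

End iid_laplace.

(** * Chi-square tail bounds *)

Section tails.
Local Open Scope classical_set_scope.
Context {R : realType}.

(* Chosen so that each tail of a chi-square variable with [m] degrees of freedom
   has probability at most [expR (- (4 * m))]. *)
Definition chi_lo : R := expR (- 9).
Definition chi_hi : R := 25.

(** The hypothesis says that [F] has the Laplace transform of [sigma] times a chi-square variable
    with [m] degrees of freedom. Chernoff's bound is applied to [- F] for the lower tail and to [F]
    for the upper one. *)
Lemma chi2_tails d (T : measurableType d) (P : probability T R)
    (F : T -> R) (sigma : R) (m : nat) :
  measurable_fun setT F -> 0 < sigma ->
  (forall l, 0 < 1 + 2 * l * sigma ->
    (\int[P]_w (expR (- l * F w))%:E =
     ((Num.sqrt (1 + 2 * l * sigma))^-1 ^+ m)%:E)%E) ->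
  (P [set w | ~~ (chi_lo * sigma * m%:R <= F w <= chi_hi * sigma * m%:R)%R]
    <= (2 * expR (- (4 * m%:R)))%:E)%E.
Proof.
move=> mF s0 HF.
have mNF : measurable_fun setT (fun w => - F w) by exact: measurableT_comp.
pose X : {RV P >-> R} := HB.pack F (isMeasurableFun.Build _ _ _ _ F mF).
pose Y : {RV P >-> R} :=
    HB.pack (fun w => - F w) (isMeasurableFun.Build _ _ _ _ (fun w => - F w) mNF).
have s1 : sigma != 0 by rewrite gt_eqF.
have lo : (P [set w | F w <= chi_lo * sigma * m%:R]%R <=
    (expR (- (4 * m%:R)))%:E)%E.
  (* With this [l] each degree of freedom contributes [(1 + e^9)^(-1/2) e^(1/2)], which is at most
     [e^(-9/2 + 1/2) = e^(-4)]. *)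
  pose l : R := expR 9 / 2.
  have l0 : 0 < l by rewrite divr_gt0// expR_gt0.
  have ls0 : 0 < l / sigma by rewrite divr_gt0.
  have := chernoff Y (- (chi_lo * sigma * m%:R)) ls0.
  rewrite /mmt_gen_fun unlock.
  rewrite (_ : \int[P]_w _ = \int[P]_w (expR (- (l / sigma) * F w))%:E)%E;
      last first.
    by apply: eq_integral => w _; congr (expR _)%:E => /=; ring.
  have E1 : 1 + 2 * (l / sigma) * sigma = 1 + expR 9.
    by rewrite /l; field.
  rewrite HF E1; last by rewrite addr_gt0// expR_gt0.
  rewrite (_ : [set w | _] = [set w | F w <= chi_lo * sigma * m%:R]%R); last first.
    by apply: eq_set => w; rewrite /= lerN2.
  move=> /le_trans; apply.
  rewrite -EFinM lee_fin.
  have -> : - (l / sigma * - (chi_lo * sigma * m%:R)) = m%:R * (1 / 2) :> R.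
    by rewrite /l /chi_lo expRN; field; rewrite s1 gt_eqF ?expR_gt0.
  have -> : - (4 * m%:R) = m%:R * (- (9 / 2) + 1 / 2) :> R by field.
  rewrite !expRM_natl (expRD (- (9 / 2)) (1 / 2)) [leRHS]exprMn ler_pM2r;
      last by rewrite exprn_gt0// expR_gt0.
  rewrite lerXn2r ?nnegrE ?invr_ge0 ?sqrtr_ge0 ?expR_ge0//.
  have sp : 0 < Num.sqrt (1 + expR 9 : R) by rewrite sqrtr_gt0 addr_gt0// expR_gt0.
  rewrite expRN lef_pV2 ?posrE ?expR_gt0//.
  rewrite -(@ler_pXn2r _ 2)// ?nnegrE ?expR_ge0 ?sqrtr_ge0//.
  rewrite sqr_sqrtr; last by rewrite addr_ge0// expR_ge0.
  rewrite -expRM_natl (_ : 2%:R * (9 / 2) = 9)//; last by field.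
  by rewrite lerDr.
have hi : (P [set w | chi_hi * sigma * m%:R <= F w]%R <=
    (expR (- (4 * m%:R)))%:E)%E.
  (* At [l = - 1 / (4 sigma)] the determinant factor is [1/2], and each degree of freedom
     contributes [sqrt 2 * e^(-25/4)], at most [e^(-4)] because [sqrt 2 <= 1 + 9/4 <= e^(9/4)]. *)
  have ls0 : 0 < 4^-1 / sigma by rewrite divr_gt0// invr_gt0.
  have := chernoff X (chi_hi * sigma * m%:R) ls0.
  rewrite /mmt_gen_fun unlock.
  rewrite (_ : \int[P]_w _ = \int[P]_w (expR (- (- (4^-1 / sigma)) * F
      w))%:E)%E; last first.
    by apply: eq_integral => w _; congr (expR _)%:E => /=; ring.
  have E1 : 1 + 2 * (- (4^-1 / sigma)) * sigma = 2^-1.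
    by field.
  rewrite HF E1; last by rewrite invr_gt0.
  move=> /le_trans; apply.
  rewrite -EFinM lee_fin.
  have -> : - (4^-1 / sigma * (chi_hi * sigma * m%:R)) = m%:R * (- (25 / 4)) :> R.
    by rewrite /chi_hi; field.
  have -> : - (4 * m%:R) = m%:R * (9 / 4 + - (25 / 4)) :> R by field.
  rewrite !expRM_natl (expRD (9 / 4) (- (25 / 4))) [leRHS]exprMn ler_pM2r;
      last by rewrite exprn_gt0// expR_gt0.
  rewrite lerXn2r ?nnegrE ?invr_ge0 ?sqrtr_ge0 ?expR_ge0//.
  rewrite sqrtrV// invrK.
  apply: le_trans (expR_ge1Dx _).
  rewrite -(@ler_pXn2r _ 2)// ?nnegrE ?sqrtr_ge0// ?sqr_sqrtr//; lra.
have mle a : measurable [set w | (F w <= a)%R].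
  by have := mF measurableT `]-oo, a] (measurable_itv _); rewrite setTI.
have mge a : measurable [set w | (a <= F w)%R].
  have := mF measurableT `[a, +oo[ (measurable_itv _); rewrite setTI.
  by rewrite (_ : F @^-1` _ = [set w | a <= F w]%R)//; apply/seteqP;
      split=> w /=; rewrite in_itv/= andbT.
have mbad : measurable [set w | ~~ (chi_lo * sigma * m%:R <= F w <=
    chi_hi * sigma * m%:R)%R].
  have := measurableC (measurableI _ _ (mge (chi_lo * sigma * m%:R)) (mle
      (chi_hi * sigma * m%:R))).
  rewrite (_ : ~` _ = [set w | ~~ (chi_lo * sigma * m%:R <= F w <=
      chi_hi * sigma * m%:R)%R])//.
  apply/seteqP; split => w /= H; first by apply/negP => /andP.
  by move=> [h1 h2]; move: H; rewrite h1 h2.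
apply: (@le_trans _ _ (P ([set w | F w <= chi_lo * sigma * m%:R]%R `|`
    [set w | chi_hi * sigma * m%:R <= F w]%R))).
  apply: le_measure; rewrite ?inE//; first exact: measurableU.
  move=> w /=; rewrite negb_and -!ltNge => /orP[/ltW|/ltW] ?; by [left|right].
apply: le_trans (measureU2 _ (mle _) (mge _)) _.
by rewrite mulr_natl mulr2n EFinD leeD.
Qed.

End tails.

(** * Euclidean norm and lattice points *)

Section euclidean_norm.
Context {R : realType}.

(** The sum of the squares [(B a_i - C b_i)^2] equals [B (A B - C^2)], which settles the case
    [B > 0]; if [B = 0] then [b] vanishes. *)
Lemma sum_cauchy_schwarz (I : finType) (a b : I -> R) :
  (\sum_i a i * b i) ^+ 2 <= (\sum_i a i ^+ 2) * (\sum_i b i ^+ 2).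
Proof.
set A := \sum_i a i ^+ 2; set B := \sum_i b i ^+ 2; set C := \sum_i a i * b i.
have B0 : 0 <= B by apply: sumr_ge0 => i _; exact: sqr_ge0.
have : 0 <= \sum_i (B * a i - C * b i) ^+ 2.
  by apply: sumr_ge0 => i _; exact: sqr_ge0.
rewrite (_ : \sum_i _ = B * (A * B - C ^+ 2)); last first.
  rewrite (eq_bigr (fun i => B ^+ 2 * a i ^+ 2 +
    (- (2 * B * C)) * (a i * b i) + C ^+ 2 * b i ^+ 2)); last by move=> i _; ring.
  by rewrite !big_split/= -!mulr_sumr -/A -/B -/C; ring.
have [Beq|B1] := eqVneq B 0; last first.
  by rewrite pmulr_rge0 ?subr_ge0// lt_neqAle eq_sym B1.
move=> _; rewrite Beq mulr0 /C big1 ?expr0n// => i _.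
have /eqP := psumr_eq0P (P := xpredT) (fun i _ => sqr_ge0 (b i)) Beq isT (i := i).
by rewrite sqrf_eq0 => /eqP ->; rewrite mulr0.
Qed.

Variable q : nat.
Implicit Types u v : 'rV[R]_q.

Lemma l2norm_ge0 u : 0 <= l2norm u.
Proof. exact: sqrtr_ge0. Qed.

Lemma l2norm_sqr u : l2norm u ^+ 2 = \sum_(j < q) u ord0 j ^+ 2.
Proof. by rewrite sqr_sqrtr// sumr_ge0// => j _; exact: sqr_ge0. Qed.

Lemma l2norm_le u a : 0 <= a -> \sum_(j < q) u ord0 j ^+ 2 <= a ^+ 2 ->
  l2norm u <= a.
Proof.
by move=> a0 H; rewrite -(@ler_pXn2r _ 2) ?nnegrE ?l2norm_ge0// l2norm_sqr.
Qed.

Lemma sum_mul_le_l2norm u v :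
  \sum_(j < q) u ord0 j * v ord0 j <= l2norm u * l2norm v.
Proof.
apply: le_trans (ler_norm _) _.
rewrite -(@ler_pXn2r _ 2) ?nnegrE ?mulr_ge0 ?l2norm_ge0 ?normr_ge0//.
by rewrite -normrX ger0_norm ?sqr_ge0// exprMn !l2norm_sqr sum_cauchy_schwarz.
Qed.

Lemma l2normD u v : l2norm (u + v) <= l2norm u + l2norm v.
Proof.
apply: l2norm_le; first by rewrite addr_ge0 ?l2norm_ge0.
under eq_bigr do rewrite mxE sqrrD.
rewrite sqrrD !l2norm_sqr !big_split/= lerD2r lerD2l.
by rewrite mulr2n lerD// sum_mul_le_l2norm.
Qed.

Lemma l2normZ a u : l2norm (a *: u) = `|a| * l2norm u.
Proof.
rewrite /l2norm; under eq_bigr do rewrite mxE exprMn.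
by rewrite -mulr_sumr sqrtrM ?sqr_ge0// sqrtr_sqr.
Qed.

Lemma l2norm_eq0 u : (l2norm u == 0) = (u == 0).
Proof.
apply/eqP/eqP => [u0|->]; last first.
  by rewrite /l2norm big1 ?sqrtr0// => j _; rewrite mxE expr0n.
have : \sum_(j < q) u ord0 j ^+ 2 = 0 by rewrite -l2norm_sqr u0 expr0n.
move=> /(psumr_eq0P (P := xpredT) (fun j _ => sqr_ge0 _)) H; apply/rowP => j.
by have /eqP := H j isT; rewrite sqrf_eq0 mxE => /eqP.
Qed.

Lemma l2normN u : l2norm (- u) = l2norm u.
Proof. by rewrite -scaleN1r l2normZ normrN1 mul1r. Qed.

Lemma abs_le_l2norm u j : `|u ord0 j| <= l2norm u.
Proof.
rewrite -(@ler_pXn2r _ 2) ?nnegrE ?l2norm_ge0 ?normr_ge0// l2norm_sqr.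
rewrite real_normK ?num_real// (bigD1 j)//= lerDl.
by apply: sumr_ge0 => i _; exact: sqr_ge0.
Qed.

End euclidean_norm.

Section grid.
Context {R : realType} {q : nat}.

(** The absolute difference: with truncated subtraction at least one summand is zero. *)
Definition dist_to (K a : nat) : nat := (a - K) + (K - a).

(* Coordinate [z j] encodes the integer [z j - K], between [-K] and [K]. *)
Definition grid_vec K (z : {ffun 'I_q -> 'I_(2 * K).+1}) : 'rV[R]_q :=
  \row_j ((z j)%:R - K%:R).

Definition grid (S : {set 'I_q}) K : {set {ffun 'I_q -> 'I_(2 * K).+1}} :=
  [set z : {ffun 'I_q -> 'I_(2 * K).+1} | [forall j, (j \in S) || (z j == K :>
      nat)] &&
     (\sum_j dist_to K (z j) ^ 2 <= K)%N].

Lemma dist_toE K a : (dist_to K a)%:R ^+ 2 = (a%:R - K%:R) ^+ 2 :> R.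
Proof.
rewrite /dist_to; have [aK|/ltnW Ka] := leqP a K.
  by rewrite (eqP aK) natrB// -sqrrN opprB.
by rewrite (eqP Ka) addn0 natrB.
Qed.

Lemma sum_weights K :
  \sum_(a < (2 * K).+1) 2^-1 ^+ dist_to K a = 3 - 2 * 2^-1 ^+ K :> R.
Proof.
elim: K => [|K IH]; first by rewrite big_ord1 /= !expr0; ring.
rewrite mulnS 2!addSn add0n big_ord_recl big_ord_recr/=.
rewrite (eq_bigr (fun a : 'I_(2 * K).+1 => 2^-1 ^+ dist_to K a)); last first.
  by move=> i _; rewrite /dist_to /bump/= add1n !subSS.
rewrite IH /dist_to /bump/= add1n !subSS sub0n subn0 add0n.
rewrite (_ : (2 * K).+1 - K = K.+1)%N; last by rewrite mul2n -addnn subSn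
    ?leq_addl// addnK.
rewrite (_ : K - (2 * K).+1 = 0)%N ?addn0; last first.
  by apply/eqP; rewrite subn_eq0 ltnW// ltnS leq_pmull.
by rewrite exprS; field.
Qed.

(** Give an integer vector [x] the weight [2^(- sum_j |x_j|)]. As [|x_j| <= x_j^2], grid points
    weigh at least [2^(-K)], while the total weight factors over coordinates, with a factor at most
    3 on [S] by [sum_weights] and 1 elsewhere. *)
Lemma card_grid S K : (#|grid S K| <= 2 ^ K * 3 ^ #|S|)%N.
Proof.
rewrite -(ler_nat R) natrM !natrX.
pose w (a : 'I_(2 * K).+1) : R := 2^-1 ^+ dist_to K a.
pose Pd (j : 'I_q) : pred 'I_(2 * K).+1 :=
  fun a => (j \in S) || (a == K :> nat).
have w0 a : 0 <= w a by rewrite exprn_ge0.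
apply: (@le_trans _ _ (2 ^+ K * \sum_(z in family Pd) \prod_j w (z j))).
  rewrite mulr_sumr -sum1_card natr_sum.
  apply: (@le_trans _ _ (\sum_(z in grid S K) 2 ^+ K * \prod_j w (z j))).
    apply: ler_sum => z; rewrite inE => /andP[_ zK].
    rewrite -[1%:R](@mulfV _ (2 ^+ K)) ?expf_neq0//.
    rewrite ler_pM2l ?exprn_gt0// -exprVn.
    rewrite prodrXr ler_wiXn2l//; last first.
      apply: leq_trans _ zK; apply: leq_sum => j _.
      by case: (dist_to _ _) => // n; rewrite expnS expn1 leq_pmull.
    by rewrite invf_le1// ler1n.
  rewrite [leRHS](bigID (mem (grid S K)))/=.
  rewrite [X in X <= _](eq_bigl (fun z => (z \in family Pd) && (z \in grid S K))).
    rewrite lerDl; apply: sumr_ge0 => z _; apply: mulr_ge0.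
      by rewrite exprn_ge0.
    exact: prodr_ge0.
  move=> z; rewrite andb_idl// inE => /andP[/forallP H _].
  by apply/familyP => j; exact: H.
rewrite -(bigA_distr_big_dep _ (fun j a => w a)) ler_pM2l ?exprn_gt0//.
rewrite (bigID (mem S))/= [X in _ * X]big1 ?mulr1; last first.
  move=> j /negbTE jS; rewrite (big_pred1 (inord K)).
    by rewrite /w /dist_to inordK ?subnn// ltnS leq_pmull.
  move=> a; rewrite /Pd jS/=; apply/eqP/eqP => [aK|->].
    by apply/val_inj; rewrite /= inordK ?aK// ltnS leq_pmull.
  by rewrite inordK// ltnS leq_pmull.
rewrite -prodr_const; apply: ler_prod => j jS; apply/andP; split.
  exact: sumr_ge0.
rewrite (eq_bigl xpredT) => [|a]; last by rewrite /Pd jS.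
by rewrite sum_weights gerBl mulr_ge0// exprn_ge0.
Qed.

(** Rounding is towards zero so that the absolute value cannot grow; the rounded vector then
    inherits the norm bound and the support. *)
Lemma exists_trunc (K : nat) (x : R) : `|x| <= K%:R ->
  exists a : 'I_(2 * K).+1,
    (a%:R - K%:R) ^+ 2 <= x ^+ 2 /\ (x - (a%:R - K%:R)) ^+ 2 <= 1.
Proof.
move=> xK; have := truncn_itv (normr_ge0 x); set t := Num.trunc _ => /andP[tx xt].
have tK : (t <= K)%N by rewrite -(ler_nat R) (le_trans tx).
have xt' : `|x| < t%:R + 1 by rewrite natr1.
have t0 : 0 <= t%:R :> R by [].
have [x0|x0] := leP 0 x.
  rewrite ger0_norm// in tx xt'.
  have H : (K + t < (2 * K).+1)%N by rewrite ltnS mul2n -addnn leq_add2l.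
  exists (Ordinal H) => /=; rewrite natrD.
  have -> : K%:R + t%:R - K%:R = t%:R :> R by ring.
  by split; nra.
rewrite ltr0_norm// in tx xt'.
have H : (K - t < (2 * K).+1)%N.
  by rewrite ltnS (leq_trans (leq_subr _ _))// leq_pmull.
exists (Ordinal H) => /=; rewrite natrB//.
have -> : K%:R - t%:R - K%:R = - t%:R :> R by ring.
by split; nra.
Qed.

Lemma grid_approx (S : {set 'I_q}) (d L : nat) (u : 'rV[R]_q) :
  (0 < d)%N -> (0 < L)%N -> (#|S| <= d)%N ->
  (forall j, j \notin S -> u ord0 j = 0) ->
  \sum_j u ord0 j ^+ 2 <= (L ^ 2 * d)%:R ->
  exists2 z, z \in grid S (L ^ 2 * d) &
    (forall j, j \notin S -> grid_vec z ord0 j = 0) /\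
    \sum_j (u ord0 j - grid_vec z ord0 j) ^+ 2 <= d%:R.
Proof.
set K := (L ^ 2 * d)%N => d0 L0 Sd uS uK.
have K0 : (0 < K)%N by rewrite muln_gt0 expn_gt0 L0.
have K1 : 1 <= K%:R :> R by rewrite ler1n.
have uKj j : `|u ord0 j| <= K%:R.
  have H : u ord0 j ^+ 2 <= K%:R.
    apply: le_trans uK; rewrite (bigD1 j)//= lerDl.
    by apply: sumr_ge0 => i _; exact: sqr_ge0.
  rewrite -(@ler_pXn2r _ 2) ?nnegrE ?normr_ge0//.
  by rewrite real_normK ?num_real//; apply: le_trans H _; nra.
pose z : {ffun 'I_q -> 'I_(2 * K).+1} :=
    [ffun j => sval (cid (exists_trunc (uKj j)))].
have zP j : (grid_vec z ord0 j) ^+ 2 <= u ord0 j ^+ 2 /\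
    (u ord0 j - grid_vec z ord0 j) ^+ 2 <= 1.
  by rewrite mxE ffunE; case: cid.
have zS j : j \notin S -> grid_vec z ord0 j = 0.
  move=> /uS uj; have [+ _] := zP j; rewrite uj expr0n/= => H.
  by apply/eqP; rewrite -sqrf_eq0 eq_le H sqr_ge0.
exists z; last split=> //.
  rewrite inE; apply/andP; split.
    apply/forallP => j; rewrite -implyNb; apply/implyP => /zS /eqP.
    by rewrite mxE subr_eq0 eqr_nat.
  rewrite -(ler_nat R); apply: le_trans uK; rewrite natr_sum.
  apply: ler_sum => j _; rewrite natrX dist_toE.
  by have [+ _] := zP j; rewrite mxE.
apply: (@le_trans _ _ #|S|%:R); last by rewrite ler_nat.
rewrite -sum1_card natr_sum (bigID (mem S))/= addrC big1 ?add0r.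
  by apply: ler_sum => j _; have [] := zP j.
by move=> j jS; rewrite zS// uS// subr0 expr0n.
Qed.

End grid.

(** * Nets and peeling *)

Section seminorm_net_arith.
Context {R : realType}.
Implicit Types t L x A b c : R.

(** Here [x] is the seminorm of a unit vector, [L * t] the dilation applied before rounding, and [t]
    bounds the rounding error. *)
Lemma net_upper_arith t L x A b : 0 < t -> 2 <= L -> 0 <= A -> 0 <= b ->
  L * t * x <= A * (L * t + t) + b * t -> x <= 3 / 2 * A + b / 2.
Proof.
move=> t0 L2 A0 b0 H.
have H1 : L * x <= A * (L + 1) + b.
  rewrite -(ler_pM2r t0); apply: le_trans (le_trans _ H) _.
    by rewrite le_eqVlt; apply/orP; left; apply/eqP; ring.
  by rewrite le_eqVlt; apply/orP; left; apply/eqP; ring.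
have L0 : 0 < L by apply: lt_le_trans L2.
rewrite -(ler_pM2l L0); apply: le_trans H1 _.
have : 0 <= (L - 2) * (A + b) by rewrite mulr_ge0 ?subr_ge0//; apply: addr_ge0.
lra.
Qed.

Lemma net_lower_arith t L x A c : 0 < t -> 2 <= L -> 0 < c -> 12 * A <= c * L ->
  c * (L * t - t) <= L * t * x + 3 * A * t -> c / 4 <= x.
Proof.
move=> t0 L2 c0 cAL H.
have H1 : c * (L - 1) <= L * x + 3 * A.
  rewrite -(ler_pM2r t0); apply: le_trans (le_trans _ H) _.
    by rewrite le_eqVlt; apply/orP; left; apply/eqP; ring.
  by rewrite le_eqVlt; apply/orP; left; apply/eqP; ring.
have L0 : 0 < L by apply: lt_le_trans L2.
rewrite -(ler_pM2l L0).
have : 0 <= (L - 2) * c by rewrite mulr_ge0 ?subr_ge0// ltW.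
lra.
Qed.

End seminorm_net_arith.

Section seminorm_net.
Context {R : realType} {q : nat}.
Variable N : 'rV[R]_q -> R.
Hypothesis ND : forall u v, N (u + v) <= N u + N v.
Hypothesis NZ : forall a u, N (a *: u) = `|a| * N u.

Lemma seminorm0 : N 0 = 0.
Proof. by rewrite -(scale0r 0) NZ normr0 mul0r. Qed.

Lemma seminormN u : N (- u) = N u.
Proof. by rewrite -scaleN1r NZ normrN1 mul1r. Qed.

Lemma seminorm_ge0 u : 0 <= N u.
Proof. by have := ND u (- u); rewrite subrr seminorm0 seminormN; lra. Qed.

(** Expansion in the canonical basis. The size of [F] is irrelevant: it only starts the iteration in
    [upper]. *)
Lemma seminorm_bounded : exists2 F, 0 <= F & forall u, N u <= F * l2norm u.
Proof.
exists (\sum_j N (delta_mx 0 j)).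
  by apply: sumr_ge0 => j _; exact: seminorm_ge0.
move=> u; rewrite {1}(row_sum_delta u) mulr_suml.
apply: (@le_trans _ _ (\sum_j N (u ord0 j *: delta_mx 0 j))).
  elim/big_ind2: _ => [|x1 x2 y1 y2 h1 h2|//]; first by rewrite seminorm0.
  exact: le_trans (ND _ _) (lerD h1 h2).
apply: ler_sum => j _; rewrite NZ mulrC ler_wpM2l ?seminorm_ge0//.
exact: abs_le_l2norm.
Qed.

Variables (S : {set 'I_q}) (d L : nat) (c A : R).
Hypotheses (d0 : (0 < d)%N) (Sd : (#|S| <= d)%N) (L2 : (2 <= L)%N).
Hypotheses (c0 : 0 < c) (A0 : 0 <= A) (cAL : 12 * A <= c * L%:R).
Hypothesis net : forall z, z \in grid S (L ^ 2 * d) ->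
  c * l2norm (grid_vec z : 'rV[R]_q) <= N (grid_vec z)
  <= A * l2norm (grid_vec z : 'rV[R]_q).

Let t : R := Num.sqrt d%:R.
Let t0 : 0 < t. Proof. by rewrite sqrtr_gt0 ltr0n. Qed.
Let tt : t ^+ 2 = d%:R. Proof. by rewrite sqr_sqrtr. Qed.
Let L0 : 0 < L%:R :> R. Proof. by rewrite ltr0n (leq_trans _ L2). Qed.
Let L2R : 2 <= L%:R :> R. Proof. by rewrite (ler_nat R 2). Qed.

Let supp (u : 'rV[R]_q) := forall j, j \notin S -> u ord0 j = 0.

(** Rounding costs at most [t = sqrt d]; dilating by [L * t] first makes this a fraction [1 / L] of
    the scale, at the price of [L ^ 2 * d] in the grid. *)
Let approx u : supp u -> l2norm u <= 1 ->
  exists z r, [/\ z \in grid S (L ^ 2 * d), supp r, l2norm r <= t &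
    (L%:R * t) *: u = grid_vec z + r].
Proof.
move=> uS u1; have L1 := ltnW L2.
have [j jS||z zG [zS ztr]] := @grid_approx R q S d L ((L%:R * t) *: u) d0 L1 Sd.
- by rewrite mxE uS// mulr0.
- under eq_bigr do rewrite mxE exprMn.
  rewrite -mulr_sumr -l2norm_sqr exprMn tt natrM natrX.
  rewrite ler_piMr// ?mulr_ge0 ?exprn_ge0//.
  by rewrite expr_le1 ?l2norm_ge0.
- exists z, ((L%:R * t) *: u - grid_vec z); split=> //.
  + by move=> j jS; rewrite mxE [X in X + _]mxE uS// mulr0 mxE zS// subr0.
  + apply: l2norm_le; first exact: ltW.
    rewrite tt (le_trans _ ztr)//.
    by rewrite le_eqVlt; apply/orP; left; apply/eqP/eq_bigr => j _; rewrite !mxE.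
  + by rewrite addrC subrK.
Qed.

(* One rounding step turns the bound [b] on the unit ball into
   [3 / 2 * A + b / 2]; iterating gives the fixed point [3 * A]. *)
Let upper_step b : 0 <= b ->
  (forall u, supp u -> l2norm u <= 1 -> N u <= b) ->
  forall u, supp u -> l2norm u <= 1 -> N u <= 3 / 2 * A + b / 2.
Proof.
move=> b0 bP u uS u1; have [z [r [zG rS rt E]]] := approx uS u1.
have Nr : N r <= b * t.
  have -> : r = t *: (t^-1 *: r) by rewrite scalerA mulfV ?scale1r ?gt_eqF.
  rewrite NZ gtr0_norm// mulrC ler_pM2r// bP//.
    by move=> j jS; rewrite mxE rS// mulr0.
  by rewrite l2normZ ger0_norm ?invr_ge0 ?(ltW t0)// mulrC ler_pdivrMr// mul1r.
have zn : l2norm (grid_vec z) <= L%:R * t + t.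
  have -> : grid_vec z = (L%:R * t) *: u + (- r) by rewrite E addrK.
  apply: le_trans (l2normD _ _) _; rewrite l2normN l2normZ lerD//.
  by rewrite ger0_norm ?mulr_ge0 ?(ltW t0)// ler_piMr// mulr_ge0 ?(ltW t0).
have /andP[_ Nz] := net zG.
have Nu : L%:R * t * N u <= A * (L%:R * t + t) + b * t.
  have := NZ (L%:R * t) u; rewrite ger0_norm ?mulr_ge0 ?(ltW t0)// => <-.
  rewrite E (le_trans (ND _ _))// lerD// (le_trans Nz)//.
  exact: ler_wpM2l.
exact: net_upper_arith Nu.
Qed.

Let upper u : supp u -> l2norm u <= 1 -> N u <= 3 * A.
Proof.
have [F F0 FP] := seminorm_bounded.
have H k : forall u, supp u -> l2norm u <= 1 -> N u <= 3 * A + F / 2 ^+ k.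
  elim: k => [|k IH] v vS v1.
    rewrite expr0 divr1 (le_trans (FP v))//.
    by rewrite ler_wpDl ?mulr_ge0// ler_piMr.
  have b0 : 0 <= 3 * A + F / 2 ^+ k.
    by rewrite addr_ge0 ?mulr_ge0 ?invr_ge0 ?exprn_ge0.
  apply: le_trans (upper_step b0 IH vS v1) _.
  rewrite exprS le_eqVlt; apply/orP; left; apply/eqP; field.
  by rewrite expf_neq0.
move=> uS u1; rewrite leNgt; apply/negP => lt.
pose e := N u - 3 * A; have e0 : 0 < e by rewrite subr_gt0.
(* Then [2^(k+1) >= k + 1 > F / e], so after [k + 1] rounds the excess over [3 * A] is below [e], a
   contradiction. *)
pose k := Num.trunc (F / e).
have /andP[_ Fk] : k%:R <= F / e < k.+1%:R by rewrite truncn_itv// divr_ge0// ltW.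
have kk : k.+1%:R <= 2 ^+ k.+1 :> R by rewrite -natrX ler_nat ltnW// ltn_expl.
have := H k.+1 u uS u1; apply/negP; rewrite -ltNge -ltrBrDl -/e.
rewrite ltr_pdivrMr ?exprn_gt0// mulrC -ltr_pdivrMr//.
exact: lt_le_trans Fk kk.
Qed.

(** The rounding error of a unit vector costs at most [3 * A * t] by [upper], and [12 * A <= c * L]
    makes this at most a quarter of the main term [c * L * t]. *)
Lemma seminorm_net u : supp u ->
  c / 4 * l2norm u <= N u <= 3 * A * l2norm u.
Proof.
move=> uS; have [u0|u0] := eqVneq (l2norm u) 0.
  move/eqP: u0; rewrite l2norm_eq0 => /eqP ->.
  by rewrite seminorm0 (_ : l2norm 0 = 0) ?mulr0 ?lexx//; apply/eqP;
      rewrite l2norm_eq0.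
have nu0 : 0 < l2norm u by rewrite lt_neqAle eq_sym u0 l2norm_ge0.
suff H v : supp v -> l2norm v = 1 -> c / 4 <= N v <= 3 * A.
  have /andP[lo hi] : c / 4 <= N ((l2norm u)^-1 *: u) <= 3 * A.
    apply: H; first by move=> j jS; rewrite mxE uS// mulr0.
    by rewrite l2normZ ger0_norm ?invr_ge0 ?l2norm_ge0// mulVf.
  move: lo hi; rewrite NZ ger0_norm ?invr_ge0 ?l2norm_ge0//.
  by rewrite ler_pdivlMl// ler_pdivrMl// ![l2norm u * _]mulrC => -> ->.
move=> vS v1; apply/andP; split; last by apply: upper; rewrite ?v1.
have [|z [r [zG rS rt E]]] := approx vS; first by rewrite v1.
have Nr : N r <= 3 * A * t.
  have -> : r = t *: (t^-1 *: r) by rewrite scalerA mulfV ?scale1r ?gt_eqF.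
  rewrite NZ gtr0_norm// mulrC ler_pM2r// upper//.
    by move=> j jS; rewrite mxE rS// mulr0.
  by rewrite l2normZ ger0_norm ?invr_ge0 ?(ltW t0)// mulrC ler_pdivrMr// mul1r.
have zn : L%:R * t - t <= l2norm (grid_vec z).
  have := l2normD (grid_vec z) r; rewrite -E l2normZ v1 mulr1.
  by rewrite ger0_norm ?mulr_ge0 ?(ltW t0)//; lra.
have /andP[Nz _] := net zG.
have Nv : c * (L%:R * t - t) <= L%:R * t * N v + 3 * A * t.
  have := NZ (L%:R * t) v; rewrite ger0_norm ?mulr_ge0 ?(ltW t0)// => <-.
  apply: le_trans (ler_wpM2l (ltW c0) zn) _; apply: le_trans Nz _.
  have -> : grid_vec z = (L%:R * t) *: v + (- r) by rewrite E addrK.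
  by apply: le_trans (ND _ _) _; rewrite seminormN lerD2l.
exact: net_lower_arith Nv.
Qed.

End seminorm_net.

Section peeling.
Context {R : realType} {I : finType}.
Implicit Types (T : {set I}) (g : I -> R) (f : {set I} -> R).

Lemma exists_top_set g k T : (k <= #|T|)%N ->
  exists2 T0 : {set I}, T0 \subset T /\ #|T0| = k &
    forall i j, i \in T0 -> j \in T :\: T0 -> g j <= g i.
Proof.
elim: k => [_|k IH kT].
  by exists finset.set0; rewrite ?finset.sub0set ?cards0// => i j; rewrite inE.
have [T0 [T0T T0k] top] := IH (ltnW kT).
have /card_gt0P[i0 i0T] : (0 < #|T :\: T0|)%N.
  by rewrite cardsD (finset.setIidPr T0T) T0k subn_gt0.
have [i iT imax] := @arg_maxP _ R _ i0 (mem (T :\: T0)) g i0T.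
have iT' : i \in T :\: T0 by exact: iT.
have /andP[iT0 iinT] : (i \notin T0) && (i \in T) by rewrite inE in iT'.
exists (i |: T0); first split.
- by rewrite finset.subUset finset.sub1set iinT.
- by rewrite cardsU1 iT0 T0k.
- move=> a b; rewrite !inE => /orP[/eqP ->|aT0] /andP[];
    rewrite negb_or => /andP[bi bT0] bT.
    by apply: (imax b); apply: (_ : b \in T :\: T0); rewrite inE bT0 bT.
  by apply: top => //; rewrite inE bT0.
Qed.

Lemma sum_sqr_le g k T m : (forall i, 0 <= g i) -> (#|T| <= k)%N -> 0 <= m ->
  (forall i, i \in T -> g i <= m) ->
  Num.sqrt (\sum_(i in T) g i ^+ 2) <= Num.sqrt k%:R * m.
Proof.
move=> g0 Tk m0 gm; rewrite -[leRHS]ger0_norm ?mulr_ge0 ?sqrtr_ge0//.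
rewrite -sqrtr_sqr ler_sqrt ?sqr_ge0// exprMn sqr_sqrtr//.
apply: (@le_trans _ _ (#|T|%:R * m ^+ 2)).
  rewrite mulr_natl -sumr_const; apply: ler_sum => i iT.
  by rewrite lerXn2r ?nnegrE// gm.
by rewrite ler_wpM2r ?sqr_ge0// ler_nat.
Qed.

(* Peel off the [k] largest groups: each of the removed groups dominates every
   remaining one, so the level [tau] may be replaced by their average. *)
Lemma peeling g f B k : (forall i, 0 <= g i) -> 0 <= B -> (0 < k)%N ->
  (forall T1 T2, [disjoint T1 & T2] -> f (T1 :|: T2) <= f T1 + f T2) ->
  (forall T, (#|T| <= k)%N -> f T <= B * Num.sqrt (\sum_(i in T) g i ^+ 2)) ->
  forall T tau, 0 <= tau -> (forall i, i \in T -> g i <= tau) ->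
    f T <= B * (Num.sqrt k%:R * tau + (\sum_(i in T) g i) / Num.sqrt k%:R).
Proof.
move=> g0 B0 k0 fU fk T; have [m] := ubnP #|T|;
    elim: m T => // m IH T Tm tau tau0 gtau.
have sk0 : 0 < Num.sqrt k%:R :> R by rewrite sqrtr_gt0 ltr0n.
have [Tk|kT] := leqP #|T| k.
  apply: le_trans (fk T Tk) _; rewrite ler_wpM2l//.
  apply: le_trans (sum_sqr_le g0 Tk tau0 gtau) _.
  by rewrite lerDl divr_ge0 ?sqrtr_ge0// sumr_ge0.
have [T0 [T0T T0k] top] := exists_top_set g (ltnW kT).
pose a : R := (\sum_(i in T0) g i) / k%:R.
have k0R : 0 < k%:R :> R by rewrite ltr0n.
have a0 : 0 <= a by rewrite divr_ge0 ?sumr_ge0.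
have ga i : i \in T :\: T0 -> g i <= a.
  move=> iT; rewrite /a ler_pdivlMr// mulr_natr -T0k -sumr_const.
  by apply: ler_sum => j jT0; exact: top.
have TE : T = T0 :|: (T :\: T0).
  apply/setP => i; rewrite !inE; case: (boolP (i \in T0)) => //=.
  by move=> /(fintype.subsetP T0T) ->.
have dis : [disjoint T0 & T :\: T0].
  by rewrite finset.disjoints_subset; apply/fintype.subsetP => i iT0;
      rewrite !inE iT0.
have cm : (#|T :\: T0| < m)%N.
  rewrite cardsD (finset.setIidPr T0T) T0k -ltnS; apply: leq_trans Tm.
  by rewrite ltnS ltn_subrL k0 (leq_trans _ kT).
have H1 := fk T0 (eq_leq T0k).
have H2 : Num.sqrt (\sum_(i in T0) g i ^+ 2) <= Num.sqrt k%:R * tau.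
  apply: sum_sqr_le; rewrite ?T0k// => i iT0; apply: gtau.
  exact: (fintype.subsetP T0T).
have H3 := IH _ cm a a0 ga.
(* The new level [a] is paid for by the part of the sum that has just been removed, so the total
   does not grow with the number of rounds. *)
have H4 : Num.sqrt k%:R * a = (\sum_(i in T0) g i) / Num.sqrt k%:R.
  rewrite /a -[in k%:R^-1](@sqr_sqrtr _ k%:R)//; field.
  by rewrite gt_eqF.
rewrite {1}TE (le_trans (fU _ _ dis))//.
apply: le_trans (lerD H1 H3) _.
rewrite -mulrDr ler_wpM2l// H4 -mulrDl.
apply: lerD => //.
by rewrite ler_pM2r ?invr_gt0// [leRHS](big_setID T0)/= (finset.setIidPr T0T).
Qed.

End peeling.

(** * Groups *)

Section projections.
Context {R : realType} {p : nat}.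
Implicit Types (S : {set 'I_p}) (h u : 'rV[R]_p).

Lemma l2norm_proj_on_sqr S h :
  l2norm (proj_on S h) ^+ 2 = \sum_(j in S) h ord0 j ^+ 2.
Proof.
rewrite l2norm_sqr [RHS]big_mkcond; apply: eq_bigr => j _; rewrite mxE.
by case: ifP => // _; rewrite expr0n.
Qed.

Lemma proj_onD S h u : proj_on S (h + u) = proj_on S h + proj_on S u.
Proof. by apply/rowP => j; rewrite !mxE; case: ifP; rewrite ?addr0. Qed.

Lemma proj_onN S h : proj_on S (- h) = - proj_on S h.
Proof. by apply/rowP => j; rewrite !mxE; case: ifP; rewrite ?oppr0. Qed.

Lemma proj_onU S1 S2 h : [disjoint S1 & S2] ->
  proj_on (S1 :|: S2) h = proj_on S1 h + proj_on S2 h.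
Proof.
move=> dis; apply/rowP => j; rewrite !mxE finset.in_setU.
have [jS1|_] := boolP (j \in S1); last by rewrite /= add0r.
by rewrite (disjointFr dis jS1) addr0.
Qed.

End projections.

Section groups.
Context {R : realType} {p M : nat} (G : 'I_M -> {set 'I_p}).
Hypothesis partG : group_partition G.
Implicit Types (T : {set 'I_M}) (h u : 'rV[R]_p).

Definition group_union T : {set 'I_p} := [set j | [exists i in T, j \in G i]].

Lemma in_group_union T i j : j \in G i -> (j \in group_union T) = (i \in T).
Proof.
case: partG => _ dis _ jG; rewrite inE; apply/existsP/idP => [[i' /andP[iT
    jG']]|iT].
  have [->//|/dis d] := eqVneq i i'.
  by rewrite (disjointFr d jG) in jG'.
by exists i; rewrite iT.
Qed.

Lemma sum_over_groups (F : 'I_p -> R) :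
  \sum_j F j = \sum_i \sum_(j in G i) F j.
Proof.
case: partG => _ dis cov.
under [RHS]eq_bigr do rewrite big_mkcond.
rewrite exchange_big/=; apply: eq_bigr => j _.
have [i jG] := cov j; rewrite (bigD1 i)//= jG big1 ?addr0// => i' ne.
by rewrite (disjointFl (dis _ _ ne) jG).
Qed.

Lemma l2norm_group_union T h : l2norm (proj_on (group_union T) h) =
  Num.sqrt (\sum_(i in T) l2norm (proj_on (G i) h) ^+ 2).
Proof.
rewrite -[LHS]ger0_norm ?l2norm_ge0// -sqrtr_sqr; congr Num.sqrt.
rewrite l2norm_proj_on_sqr big_mkcond sum_over_groups [RHS]big_mkcond.
apply: eq_bigr => i _; rewrite l2norm_proj_on_sqr.
case: ifP => iT.
  by apply: eq_bigr => j jG; rewrite (in_group_union _ jG) iT.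
by rewrite big1// => j jG; rewrite (in_group_union _ jG) iT.
Qed.

Lemma group_unionU T1 T2 :
  group_union (T1 :|: T2) = group_union T1 :|: group_union T2.
Proof.
case: partG => _ _ cov; apply/setP => j; have [i jG] := cov j.
by rewrite finset.in_setU !(in_group_union _ jG) finset.in_setU.
Qed.

Lemma disjoint_group_union T1 T2 : [disjoint T1 & T2] ->
  [disjoint group_union T1 & group_union T2].
Proof.
case: partG => _ _ cov dis; rewrite finset.disjoints_subset.
apply/fintype.subsetP => j; have [i jG] := cov j.
rewrite finset.in_setC !(in_group_union _ jG) => iT1.
by rewrite (disjointFr dis iT1).
Qed.

Lemma proj_on_group_unionT h : proj_on (group_union [set: 'I_M]) h = h.
Proof.
case: partG => _ _ cov; apply/rowP => j; have [i jG] := cov j.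
by rewrite mxE (in_group_union _ jG) finset.in_setT.
Qed.

Lemma gl_norm_ge0 h : 0 <= gl_norm G h.
Proof. by apply: sumr_ge0 => i _; exact: l2norm_ge0. Qed.

Lemma gl_normD h u : gl_norm G (h + u) <= gl_norm G h + gl_norm G u.
Proof.
rewrite /gl_norm -big_split; apply: ler_sum => i _.
by rewrite proj_onD l2normD.
Qed.

Lemma gl_normN h : gl_norm G (- h) = gl_norm G h.
Proof. by apply: eq_bigr => i _; rewrite proj_onN l2normN. Qed.

Lemma l2norm_sqr_groups h :
  l2norm h ^+ 2 = \sum_i l2norm (proj_on (G i) h) ^+ 2.
Proof.
rewrite l2norm_sqr sum_over_groups; apply: eq_bigr => i _.
by rewrite l2norm_proj_on_sqr.
Qed.

Lemma sum_groups_le T s h : (#|T| <= s)%N ->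
  \sum_(i in T) l2norm (proj_on (G i) h) <= Num.sqrt s%:R * l2norm h.
Proof.
move=> Ts; pose g i := l2norm (proj_on (G i) h).
have g0 i : 0 <= g i by exact: l2norm_ge0.
have S0 : 0 <= \sum_(i in T) g i by apply: sumr_ge0 => i _; exact: g0.
rewrite -(@ler_pXn2r _ 2) ?nnegrE ?mulr_ge0 ?sqrtr_ge0 ?l2norm_ge0//.
rewrite exprMn sqr_sqrtr// l2norm_sqr_groups.
have := sum_cauchy_schwarz (fun i => (i \in T)%:R) g.
rewrite [X in X ^+ 2](_ : _ = \sum_(i in T) g i); last first.
  rewrite [RHS]big_mkcond; apply: eq_bigr => i _.
  by case: ifP; rewrite ?mul1r ?mul0r.
move=> /le_trans; apply; apply: ler_wpM2r.
  by apply: sumr_ge0 => i _; exact: sqr_ge0.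
rewrite (eq_bigr (fun i => (i \in T)%:R)); last first.
  by move=> i _; case: (i \in T); rewrite ?expr1n ?expr0n.
rewrite -natr_sum ler_nat; apply: leq_trans Ts.
by rewrite -sum1_card [leqRHS]big_mkcond; apply: leq_sum => i _; case: (i \in T).
Qed.

Lemma gl_norm_le_l2norm h : gl_norm G h <= Num.sqrt M%:R * l2norm h.
Proof.
have := @sum_groups_le [set: 'I_M] M h; rewrite cardsT card_ord => /(_ (leqnn _)).
by rewrite /gl_norm; under eq_bigl do rewrite finset.in_setT.
Qed.

Lemma l2norm_le_gl_norm h : l2norm h <= gl_norm G h.
Proof.
rewrite -(@ler_pXn2r _ 2) ?nnegrE ?l2norm_ge0 ?gl_norm_ge0//.
rewrite l2norm_sqr_groups expr2 mulr_suml; apply: ler_sum => i _.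
rewrite expr2 ler_wpM2l ?l2norm_ge0// /gl_norm (bigD1 i)//= lerDl.
by apply: sumr_ge0 => k _; exact: l2norm_ge0.
Qed.

(** Split [h] into its [k] largest groups and the rest. The lower bound applies to the former; the
    rest is lost twice, in [N] (factor [B]) and in the Euclidean norm (factor [c]), and peeling
    bounds both losses by the group norm over [sqrt k]. *)
Lemma seminorm_group_lower (N : 'rV[R]_p -> R) (c B : R) (k : nat) :
  (forall u v, N (u + v) <= N u + N v) -> (forall a u, N (a *: u) = `|a| * N u) ->
  0 < c -> 0 <= B -> (0 < k)%N ->
  (forall T u, (#|T| <= k)%N -> (forall j, j \notin group_union T -> u ord0 j =
      0) ->
     c * l2norm u <= N u <= B * l2norm u) ->
  forall h, c * l2norm h <= N h + (c + B) * (gl_norm G h / Num.sqrt k%:R).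
Proof.
move=> ND NZ c0 B0 k0 HN h; pose g i := l2norm (proj_on (G i) h).
have g0 i : 0 <= g i by exact: l2norm_ge0.
have sk0 : 0 < Num.sqrt k%:R :> R by rewrite sqrtr_gt0 ltr0n.
have supp T j : j \notin group_union T -> proj_on (group_union T) h ord0 j = 0.
  by move=> /negbTE jT; rewrite mxE jT.
(* With at most [k] groups in total, [h] itself falls under the hypothesis. *)
have [Mk|/ltnW kM] := leqP M k.
  have /andP[lo _] : c * l2norm h <= N h <= B * l2norm h.
    rewrite -(proj_on_group_unionT h); apply: (HN [set: 'I_M]).
      by rewrite cardsT card_ord.
    exact: supp.
  rewrite (le_trans lo)// lerDl mulr_ge0 ?divr_ge0 ?gl_norm_ge0 ?sqrtr_ge0//.
  by rewrite addr_ge0// ltW.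
have [|T0 [_ T0k] top] := @exists_top_set _ _ g k [set: 'I_M].
  by rewrite cardsT card_ord.
have k0R : 0 < k%:R :> R by rewrite ltr0n.
pose a : R := (\sum_(i in T0) g i) / k%:R.
have a0 : 0 <= a by rewrite divr_ge0 ?sumr_ge0.
have ga i : i \in ~: T0 -> g i <= a.
  move=> iT; rewrite /a ler_pdivlMr// mulr_natr -T0k -sumr_const.
  by apply: ler_sum => j jT0; apply: top => //;
      rewrite finset.in_setD finset.in_setT andbT -finset.in_setC.
have glE : Num.sqrt k%:R * a + (\sum_(i in ~: T0) g i) / Num.sqrt k%:R =
    gl_norm G h / Num.sqrt k%:R.
  rewrite /gl_norm [X in _ = X / _](bigID (mem T0))/= mulrDl; congr (_ + _).
    rewrite /a -[in k%:R^-1](@sqr_sqrtr _ k%:R)//; field.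
    by rewrite gt_eqF.
  by congr (_ / _); apply: eq_bigl => i; rewrite finset.in_setC.
have decomp : h = proj_on (group_union T0) h + proj_on (group_union (~: T0)) h.
  rewrite -proj_onU; last first.
    by apply: disjoint_group_union; rewrite finset.disjoints_subset finset.setCK.
  by rewrite -group_unionU finset.setUCr proj_on_group_unionT.
have fU (F : 'rV[R]_p -> R) : (forall u v, F (u + v) <= F u + F v) ->
    forall T1 T2, [disjoint T1 & T2] -> F (proj_on (group_union (T1 :|: T2)) h) <=
      F (proj_on (group_union T1) h) + F (proj_on (group_union T2) h).
  by move=> FD T1 T2 d; rewrite group_unionU proj_onU// disjoint_group_union.
have rest : N (proj_on (group_union (~: T0)) h) <=
    B * (gl_norm G h / Num.sqrt k%:R).
  rewrite -glE; apply: (@peeling _ _ g (fun T => N (proj_on (group_union T) h)))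
      => //.
    exact: fU.
  move=> T Tk; rewrite -l2norm_group_union.
  by have /andP[] := HN T (proj_on (group_union T) h) Tk (supp T).
have rest2 : l2norm (proj_on (group_union (~: T0)) h) <=
    1 * (gl_norm G h / Num.sqrt k%:R).
  rewrite -glE; apply: (@peeling _ _ g (fun T => l2norm (proj_on (group_union T)
      h))) => //.
    by apply: fU; exact: l2normD.
  by move=> T Tk; rewrite -l2norm_group_union mul1r.
have /andP[main _] := HN T0 _ (eq_leq T0k) (supp T0).
have H1 : l2norm h <= l2norm (proj_on (group_union T0) h) + gl_norm G h /
    Num.sqrt k%:R.
  by rewrite {1}decomp (le_trans (l2normD _ _))// lerD2l -[leRHS]mul1r.
have H2 : N (proj_on (group_union T0) h) <= N h + N (proj_on (group_union (~:
    T0)) h).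
  have {1}-> : proj_on (group_union T0) h = h + - proj_on (group_union (~: T0)) h.
    by rewrite {2}decomp addrK.
  by apply: le_trans (ND _ _) _; rewrite lerD2l -scaleN1r NZ normrN1 mul1r.
have H3 := ler_wpM2l (ltW c0) H1.
by rewrite mulrDl; lra.
Qed.

Lemma min_group_le i : (min_group G <= #|G i|)%N.
Proof.
rewrite /min_group; have := mem_index_enum i; elim: (index_enum _) => // j r IH.
rewrite in_cons big_cons => /orP[/eqP->|/IH H]; first exact: geq_minl.
exact: leq_trans (geq_minr _ _) H.
Qed.

Lemma max_group_ge i : (#|G i| <= max_group G)%N.
Proof. by rewrite /max_group (bigD1 i)//= leq_maxl. Qed.

Lemma sum_card_groups : (\sum_i #|G i| = p)%N.
Proof.
apply/eqP; rewrite -(eqr_nat R); apply/eqP.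
have := sum_over_groups (fun=> 1); rewrite sumr_const card_ord => ->.
by rewrite natr_sum; apply: eq_bigr => i _; rewrite sumr_const.
Qed.

Lemma groups_mul_min_group : (M * min_group G <= p)%N.
Proof.
rewrite -[leqRHS]sum_card_groups -[X in (X * _)%N]card_ord -sum_nat_const.
by apply: leq_sum => i _; exact: min_group_le.
Qed.

Lemma min_group_gt0 : (0 < M)%N -> (0 < min_group G)%N.
Proof.
case: partG => Gpos _ _ M0; rewrite /min_group.
have p0 : (0 < p)%N.
  by apply: leq_trans (Gpos (Ordinal M0)) _; rewrite -[leqRHS]card_ord max_card.
by elim/big_ind: _ => // x y x0 y0; rewrite leq_min x0.
Qed.

Lemma min_group_le_max : (0 < M)%N -> (min_group G <= max_group G)%N.
Proof.
by move=> M0; rewrite (leq_trans (min_group_le (Ordinal M0)))// max_group_ge.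
Qed.

End groups.

(** * Least-norm solutions of underdetermined systems *)

Section least_norm_preimage.
Context {R : realType} {n p : nat}.

(** The lower bound makes the Gram matrix [Q] injective, hence invertible. With [u = xi Q^-1] and
    [e = u A], one has [|e|^2 = <xi, u> <= |xi| |u|] and [c |u| <= |e|]. *)
Lemma least_norm_preimage (A : 'M[R]_(n, p)) (c : R) : 0 < c ->
  (forall v : 'rV_n, c * l2norm v <= l2norm (v *m A)) ->
  forall xi : 'rV_n, exists2 e : 'rV_p, e *m A^T = xi &
    l2norm e <= l2norm xi / c.
Proof.
move=> c0 cA xi; pose Q := A *m A^T.
have l2E k (u : 'rV[R]_k) : (u *m u^T) ord0 ord0 = l2norm u ^+ 2.
  by rewrite l2norm_sqr mxE; apply: eq_bigr => j _; rewrite mxE expr2.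
have unitQ : Q \in unitmx.
  rewrite -row_free_unit; apply: inj_row_free => v vQ.
  have vA0 : l2norm (v *m A) = 0.
    apply/eqP; rewrite -sqrf_eq0 -l2E trmx_mul mulmxA -(mulmxA v) -/Q vQ.
    by rewrite mul0mx mxE.
  apply/eqP; rewrite -l2norm_eq0 eq_le l2norm_ge0 andbT.
  by rewrite -(ler_pM2l c0) mulr0 -vA0.
pose u := xi *m invmx Q; exists (u *m A).
  by rewrite -mulmxA -/Q mulmxKV.
have [->|e0] := eqVneq (l2norm (u *m A)) 0; first by rewrite divr_ge0
    ?l2norm_ge0// ltW.
have e_gt0 : 0 < l2norm (u *m A) by rewrite lt_neqAle eq_sym e0 l2norm_ge0.
rewrite ler_pdivlMr// -(ler_pM2l e_gt0).
have -> : l2norm (u *m A) * (l2norm (u *m A) * c) = c * l2norm (u *m A) ^+ 2.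
  by ring.
have H : l2norm (u *m A) ^+ 2 <= l2norm xi * l2norm u.
  rewrite -l2E trmx_mul mulmxA -(mulmxA u) -/Q mulmxKV//.
  rewrite mxE; apply: le_trans (sum_mul_le_l2norm _ _).
  by apply: ler_sum => j _; rewrite mxE.
apply: le_trans (ler_wpM2l (ltW c0) H) _.
by rewrite mulrCA [leRHS]mulrC ler_wpM2l ?l2norm_ge0.
Qed.

End least_norm_preimage.

(** * Deterministic recovery *)

Section recovery.
Context {R : realType} {n p M : nat} (G : 'I_M -> {set 'I_p}).
Hypotheses (n0 : (0 < n)%N) (M0 : (0 < M)%N) (partG : group_partition G).
Variables (A : 'M[R]_(n, p)) (kappa Lambda c : R).
Hypotheses (kappa0 : 0 < kappa) (Lambda0 : 0 < Lambda) (c0 : 0 < c).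
Hypothesis smin : forall v : 'rV_n, c * Num.sqrt p%:R * l2norm v <= l2norm (v *m A).
Hypothesis lower : forall h : 'rV_p, kappa * Num.sqrt n%:R * l2norm h <=
  l2norm (h *m A^T) + Lambda * Num.sqrt (max_group G)%:R * gl_norm G h.
Variables (s : nat) (hstar hhat : 'rV[R]_p) (xi : 'rV[R]_n).
Hypothesis sparse : group_sparse G s hstar.
Hypothesis hhat_fit : hhat *m A^T = hstar *m A^T + xi.
Hypothesis hhat_min : forall h : 'rV_p, h *m A^T = hstar *m A^T + xi ->
  gl_norm G hhat <= gl_norm G h.

Let m : R := (min_group G)%:R.
Let b : R := (max_group G)%:R.
Let delta : 'rV[R]_p := hhat - hstar.
Let W : R := group_ratio R G.

Let m0 : 0 < m. Proof. by rewrite ltr0n min_group_gt0. Qed.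
Let b0 : 0 < b. Proof. by rewrite ltr0n (leq_trans (min_group_gt0 partG M0))
    ?min_group_le_max. Qed.

Let pm : M%:R * m <= p%:R.
Proof. by rewrite -natrM ler_nat groups_mul_min_group. Qed.

(** The vector [hstar + e], with [e] the least-norm solution for the noise, is a competitor of
    [hhat]. Its group norm exceeds that of [hstar] by at most [sqrt M * l2norm e], and
    [M * m <= p]. *)
Lemma gl_norm_hhat : gl_norm G hhat <= gl_norm G hstar + l2norm xi / (c *
    Num.sqrt m).
Proof.
have Mpos : 0 < M%:R :> R by rewrite ltr0n.
have sm0 : 0 < Num.sqrt m by rewrite sqrtr_gt0.
have p0 : 0 < p%:R :> R by apply: lt_le_trans pm; rewrite mulr_gt0.
have sp0 : 0 < Num.sqrt p%:R :> R by rewrite sqrtr_gt0.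
have [|e eA eN] := @least_norm_preimage R n p A (c * Num.sqrt p%:R) _ smin xi.
  by rewrite mulr_gt0.
apply: (@le_trans _ _ (gl_norm G (hstar + e))).
  by apply: hhat_min; rewrite mulmxDl eA.
apply: le_trans (gl_normD _ _ _) _; rewrite lerD2l.
apply: le_trans (gl_norm_le_l2norm partG _) _.
apply: le_trans (ler_wpM2l (sqrtr_ge0 _) eN) _.
rewrite mulrCA ler_wpM2l ?l2norm_ge0//.
rewrite ler_pdivrMr ?mulr_gt0// mulrC ler_pdivlMr ?mulr_gt0//.
rewrite mulrCA ler_pM2l// -sqrtrM// ler_sqrt//.
Qed.

Let xi_bound : kappa * Num.sqrt n%:R * l2norm delta <=
  l2norm xi + Lambda * Num.sqrt b * gl_norm G delta.
Proof.
have -> : xi = delta *m A^T.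
  by rewrite mulmxBl hhat_fit [X in X - _]addrC addrK.
exact: lower.
Qed.

(** Both noise terms are absorbed by [sqrt W = sqrt (b / m)], which is at least 1. *)
Let xiW : l2norm xi + Lambda * Num.sqrt b * (l2norm xi / (c * Num.sqrt m)) <=
  (1 + Lambda / c) * (Num.sqrt W * l2norm xi).
Proof.
have sm0 : 0 < Num.sqrt m by rewrite sqrtr_gt0.
have WE : Num.sqrt W = Num.sqrt b / Num.sqrt m.
  by rewrite /W /group_ratio -/m -/b sqrtrM ?sqrtrV// ltW.
have W1 : 1 <= Num.sqrt W.
  by rewrite WE ler_pdivlMr// mul1r ler_sqrt// ler_nat min_group_le_max.
rewrite mulrDl mul1r lerD//; first by rewrite ler_peMl ?l2norm_ge0.
rewrite WE le_eqVlt; apply/orP; left; apply/eqP; field.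
by rewrite !gt_eqF.
Qed.

(** Inserts the triangle inequality for the group norm of [delta] and [gl_norm_hhat] into
    [xi_bound], then squares. *)
Lemma recovery_general : l2norm delta ^+ 2 <=
  (4 * (1 + Lambda / c) ^+ 2 + 8 * Lambda ^+ 2) / kappa ^+ 2 *
    (W * (l2norm xi ^+ 2 / n%:R) + gl_norm G hstar ^+ 2 * (b / n%:R)).
Proof.
have nR : 0 < n%:R :> R by rewrite ltr0n.
have gld : gl_norm G delta <= 2 * gl_norm G hstar + l2norm xi / (c * Num.sqrt m).
  apply: le_trans (gl_normD _ _ _) _; rewrite gl_normN.
  by have := gl_norm_hhat; lra.
have LS0 : 0 <= Lambda * Num.sqrt b by rewrite mulr_ge0 ?sqrtr_ge0 ?ltW.
have H := le_trans xi_bound (lerD (lexx _) (ler_wpM2l LS0 gld)).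
have H1 : kappa * Num.sqrt n%:R * l2norm delta <=
    (1 + Lambda / c) * (Num.sqrt W * l2norm xi) +
    2 * Lambda * (Num.sqrt b * gl_norm G hstar).
  by have := xiW; move: H; rewrite mulrDr; lra.
have W0 : 0 <= W by rewrite divr_ge0// ltW.
have H2 : kappa ^+ 2 * n%:R * l2norm delta ^+ 2 <=
    (4 * (1 + Lambda / c) ^+ 2 + 8 * Lambda ^+ 2) *
    (W * l2norm xi ^+ 2 + b * gl_norm G hstar ^+ 2).
  rewrite -[n%:R](@sqr_sqrtr _ n%:R)// -[W]sqr_sqrtr// -[b](sqr_sqrtr (ltW b0)).
  rewrite -!exprMn.
  set x := Num.sqrt W * _ in H1 *; set y := Num.sqrt b * _ in H1 *.
  have x0 : 0 <= x by rewrite mulr_ge0 ?sqrtr_ge0 ?l2norm_ge0.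
  have y0 : 0 <= y by rewrite mulr_ge0 ?sqrtr_ge0 ?gl_norm_ge0.
  set K := 1 + _ in H1 *.
  have K0 : 0 <= K by rewrite addr_ge0// divr_ge0// ltW.
  have lhs0 : 0 <= kappa * Num.sqrt n%:R * l2norm delta.
    by rewrite !mulr_ge0 ?sqrtr_ge0 ?l2norm_ge0// ltW.
  apply: (@le_trans _ _ ((K * x + 2 * Lambda * y) ^+ 2)).
    by rewrite lerXn2r ?nnegrE//; apply: le_trans H1.
  (* The inequality [(K x + 2 Lambda y)^2 <= (4 K^2 + 8 Lambda^2) (x^2 + y^2)] holds because the
     difference of its sides is a sum of squares. *)
  rewrite -subr_ge0 [leRHS](_ : _ = (K * x - 2 * Lambda * y) ^+ 2 +
    (2 * (K * x) ^+ 2 + 8 * (Lambda * x) ^+ 2 + 4 * (K * y) ^+ 2)); last by ring.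
  move: (sqr_ge0 (K * x - 2 * Lambda * y)) (sqr_ge0 (K * x)).
  by move: (sqr_ge0 (Lambda * x)) (sqr_ge0 (K * y)); lra.
rewrite [leRHS](_ : _ = (4 * (1 + Lambda / c) ^+ 2 + 8 * Lambda ^+ 2) *
    (W * l2norm xi ^+ 2 + b * gl_norm G hstar ^+ 2) / (kappa ^+ 2 * n%:R));
        last first.
  by field; rewrite !gt_eqF.
by rewrite ler_pdivlMr ?mulr_gt0 ?exprn_gt0// mulrC.
Qed.

(** The cone condition of Lasso analysis: [hstar] vanishes off [I], so minimality of [hhat] bounds
    the part of [delta] off [I] by its part on [I] plus the noise. Cauchy-Schwarz over the at most
    [s] groups of [I] gives the factor [sqrt s]. *)
Lemma gl_norm_cone : gl_norm G delta <=
  2 * (Num.sqrt s%:R * l2norm delta) + l2norm xi / (c * Num.sqrt m).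
Proof.
case: sparse => I Is glI; pose g (h : 'rV[R]_p) i := l2norm (proj_on (G i) h).
have gh0 i : i \notin I -> g hstar i = 0.
  move: glI; rewrite /gl_norm (bigID (mem I))/= -[RHS]addr0 => /addrI.
  move=> /psumr_eq0P H iI; apply: H => // j _; exact: l2norm_ge0.
have gI := sum_groups_le partG (T := I) delta Is.
have split h : gl_norm G h = \sum_(i in I) g h i + \sum_(i | i \notin I) g h i.
  by rewrite /gl_norm (bigID (mem I)).
have hh : hhat = hstar + delta by rewrite addrC subrK.
have inI : \sum_(i in I) g hstar i <= \sum_(i in I) g hhat i + \sum_(i in I) g
    delta i.
  rewrite -big_split; apply: ler_sum => i _.
  rewrite /g (_ : hstar = hhat + - delta); last by rewrite hh addrK.
  by rewrite proj_onD proj_onN (le_trans (l2normD _ _))// l2normN.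
have offI : \sum_(i | i \notin I) g delta i <= \sum_(i | i \notin I) g hhat i.
  apply: ler_sum => i iI; rewrite /g (_ : delta = hhat + - hstar)//.
  rewrite proj_onD proj_onN (le_trans (l2normD _ _))// l2normN.
  by rewrite -/(g hstar i) gh0// addr0.
have := gl_norm_hhat; rewrite (split hhat) (split hstar) (split delta).
rewrite (_ : \sum_(i | i \notin I) g hstar i = 0); last by rewrite big1.
move: gI; rewrite -/(g delta); lra.
Qed.

(** The threshold is chosen so that the term in [l2norm delta] produced by the cone bound is at most
    half of the left-hand side of [xi_bound], where it is absorbed. *)
Lemma recovery_sparse : (s * max_group G)%:R <= kappa ^+ 2 / (16 * Lambda ^+ 2)
    * n%:R ->
  l2norm delta ^+ 2 <=
  (4 * (1 + Lambda / c) ^+ 2 + 8 * Lambda ^+ 2) / kappa ^+ 2 * W * (l2norm xi ^+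
      2 / n%:R).
Proof.
move=> sb; have nR : 0 < n%:R :> R by rewrite ltr0n.
have LS0 : 0 <= Lambda * Num.sqrt b by rewrite mulr_ge0 ?sqrtr_ge0 ?ltW.
have H := le_trans xi_bound (lerD (lexx _) (ler_wpM2l LS0 gl_norm_cone)).
have W0 : 0 <= W by rewrite divr_ge0// ltW.
have sbn : Num.sqrt b * Num.sqrt s%:R <= kappa / (4 * Lambda) * Num.sqrt n%:R.
  have L4 : 0 <= 4 * Lambda by rewrite mulr_ge0// ltW.
  rewrite -(@ler_pXn2r _ 2) ?nnegrE ?mulr_ge0 ?sqrtr_ge0 ?invr_ge0 ?(ltW kappa0)//.
  rewrite !exprMn !sqr_sqrtr ?(ltW b0)//.
  move: sb; rewrite natrM mulrC -/b => /le_trans; apply.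
  rewrite le_eqVlt; apply/orP; left; apply/eqP; field.
  by rewrite gt_eqF.
have d0 := l2norm_ge0 delta.
have H1 : kappa * Num.sqrt n%:R * l2norm delta <=
    2 * (1 + Lambda / c) * (Num.sqrt W * l2norm xi).
  have := xiW; move: H; rewrite mulrDr.
  have : Lambda * Num.sqrt b * (2 * (Num.sqrt s%:R * l2norm delta)) <=
      kappa * Num.sqrt n%:R * l2norm delta / 2.
    have := ler_wpM2l (mulr_ge0 (ltW Lambda0) d0) sbn.
    have -> : Lambda * l2norm delta * (kappa / (4 * Lambda) * Num.sqrt n%:R) =
        kappa * Num.sqrt n%:R * l2norm delta / 4 by field; rewrite gt_eqF.
    by lra.
  by lra.
have H2 : kappa ^+ 2 * n%:R * l2norm delta ^+ 2 <=
    4 * (1 + Lambda / c) ^+ 2 * (W * l2norm xi ^+ 2).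
  rewrite -[n%:R](@sqr_sqrtr _ n%:R)// -[W]sqr_sqrtr//.
  rewrite (_ : 4 * _ * _ = (2 * (1 + Lambda / c) * (Num.sqrt W * l2norm xi)) ^+
      2); last by ring.
  rewrite -!exprMn lerXn2r ?nnegrE// ?mulr_ge0 ?sqrtr_ge0 ?(ltW kappa0)//.
  by rewrite addr_ge0// divr_ge0// ltW.
have x0 : 0 <= W * l2norm xi ^+ 2 by rewrite mulr_ge0// sqr_ge0.
have H3 : kappa ^+ 2 * n%:R * l2norm delta ^+ 2 <=
    (4 * (1 + Lambda / c) ^+ 2 + 8 * Lambda ^+ 2) * (W * l2norm xi ^+ 2).
  by apply: le_trans H2 _; rewrite ler_wpM2r// lerDl mulr_ge0 ?sqr_ge0.
rewrite [leRHS](_ : _ = (4 * (1 + Lambda / c) ^+ 2 + 8 * Lambda ^+ 2) * (W *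
    l2norm xi ^+ 2) / (kappa ^+ 2 * n%:R)); last first.
  by field; rewrite !gt_eqF.
by rewrite ler_pdivlMr ?mulr_gt0 ?exprn_gt0// mulrC.
Qed.

End recovery.

(** * Gaussian designs *)

Section random_design.
Local Open Scope classical_set_scope.
Context {R : realType} {d : measure_display} {T : measurableType d}.
Variable P : probability T R.

(** Measurability and the bound are proved together because subadditivity asks for measurable
    partial unions at each step. *)
Lemma finite_union_bound (I : finType) (J : {set I}) (F : I -> set T) (e : R) :
  (forall i, measurable (F i)) -> (forall i, (P (F i) <= e%:E)%E) ->
  measurable (\big[setU/set0]_(i in J) F i) /\
  (P (\big[setU/set0]_(i in J) F i) <= (#|J|%:R * e)%:E)%E.
Proof.
move=> mF Fe; rewrite -sum1_card.
pose K (x : set T) (k : nat) := measurable x /\ (P x <= (k%:R * e)%:E)%E.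
apply: (big_rec2 K) => [|i y x _ [mx xy]].
  by split; [exact: measurable0|rewrite measure0 mul0r].
split; first exact: measurableU.
apply: le_trans (measureU2 _ (mF i) mx) _.
by rewrite natrD mulrDl mul1r EFinD; exact: leeD (Fe i) xy.
Qed.

Context {n p : nat}.
Variable X : 'I_n -> {RV P >-> p.-tuple R}.

Definition design_tuple (w : T) : n.-tuple (p.-tuple R) := [tuple X i w | i < n].

Lemma measurable_design_tuple : measurable_fun setT design_tuple.
Proof.
apply/measurable_fun_tnthP => i.
rewrite (_ : _ \o _ = X i); first exact: measurable_funP.
by apply/funext => w /=; rewrite tnth_mktuple.
Qed.

HB.instance Definition _ :=
  isMeasurableFun.Build _ _ _ _ design_tuple measurable_design_tuple.

Hypothesis indep : mutually_independent X.
Hypothesis gaussX : forall i, std_gaussian (X i).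

Lemma iid_row i : iid (gauss R) (distribution P (X i)).
Proof. by move=> B mB; exact: (gaussX i mB). Qed.

Lemma iid_design i0 :
  iid (distribution P (X i0)) (distribution P design_tuple).
Proof.
(* Independence for the full index set gives a product over the laws of the rows; all of these equal
   the law of row [i0], since they agree on boxes. *)
move=> B mB; have := indep [set: 'I_n]%SET mB.
rewrite (eq_bigl xpredT); last by move=> i; rewrite finset.in_setT.
rewrite (_ : [set w | _] = design_tuple @^-1` [set t | forall i, B i (tnth t i)]).
  move=> E; rewrite [LHS]E; apply: eq_bigr => i _.
  apply: (@tuple_measure_unique _ _ _ _ (distribution P (X i))
    (distribution P (X i0))); last exact: mB.
  by move=> C mC; exact: etrans (iid_row i mC) (esym (iid_row i0 mC)).
apply/seteqP; split=> w /= Bw i.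
  by rewrite tnth_mktuple; apply: Bw; rewrite finset.in_setT.
by have := Bw i; rewrite tnth_mktuple.
Qed.

End random_design.

Section gaussian_matrix.
Context {R : realType} {n p : nat}.

Definition matrix_of (t : n.-tuple (p.-tuple R)) : 'M[R]_(n, p) :=
  \matrix_(i, j) tnth (tnth t i) j.

Variables (mu : probability (p.-tuple R) R)
  (Q : probability (n.-tuple (p.-tuple R)) R).
Hypotheses (imu : iid (gauss R) mu) (iQ : iid mu Q).

Definition bad_column (v : 'rV[R]_n) : set (n.-tuple (p.-tuple R)) :=
  [set t | ~~ (chi_lo * l2norm v ^+ 2 * p%:R <= l2norm (v *m matrix_of t) ^+ 2
    <= chi_hi * l2norm v ^+ 2 * p%:R)].

Definition bad_row (h : 'rV[R]_p) : set (n.-tuple (p.-tuple R)) :=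
  [set t | ~~ (chi_lo * l2norm h ^+ 2 * n%:R <= l2norm (h *m (matrix_of t)^T) ^+ 2
    <= chi_hi * l2norm h ^+ 2 * n%:R)].

Lemma column_sqrE v t : l2norm (v *m matrix_of t) ^+ 2 =
  \sum_(j < p) (\sum_(i < n) v ord0 i * tnth (tnth t i) j) ^+ 2.
Proof.
rewrite l2norm_sqr; apply: eq_bigr => j _; rewrite mxE; congr (_ ^+ 2).
by apply: eq_bigr => i _; rewrite mxE.
Qed.

Lemma row_sqrE h t : l2norm (h *m (matrix_of t)^T) ^+ 2 =
  \sum_(i < n) (\sum_(j < p) tnth (tnth t i) j * h ord0 j) ^+ 2.
Proof.
rewrite l2norm_sqr; apply: eq_bigr => i _; rewrite mxE; congr (_ ^+ 2).
by apply: eq_bigr => j _; rewrite !mxE mulrC.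
Qed.

Lemma measurable_column_sqr v : measurable_fun [set: n.-tuple (p.-tuple R)]
  (fun t => l2norm (v *m matrix_of t) ^+ 2).
Proof.
under eq_fun do rewrite column_sqrE.
apply: measurable_sum => j; apply: measurable_funX.
apply: measurable_sum => i; apply: measurable_funM => //.
exact: measurable_tnth2.
Qed.

Lemma measurable_row_sqr h : measurable_fun [set: n.-tuple (p.-tuple R)]
  (fun t => l2norm (h *m (matrix_of t)^T) ^+ 2).
Proof.
under eq_fun do rewrite row_sqrE.
apply: measurable_sum => i; apply: measurable_funX.
apply: measurable_sum => j; apply: measurable_funM => //.
exact: measurable_tnth2.
Qed.

Lemma measurable_itv_preimage d (T : measurableType d) (F : T -> R) (a b : R) :
  measurable_fun [set: T] F -> measurable [set t | ~~ (a <= F t <= b)]%classic.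
Proof.
move=> mF; have := measurableC (mF measurableT _ (measurable_itv `[a, b])).
rewrite setTI; congr measurable; apply/seteqP.
by split=> t /=; rewrite in_itv/= => /negP.
Qed.

Lemma measurable_bad_column v : measurable (bad_column v).
Proof. exact: measurable_itv_preimage (measurable_column_sqr _). Qed.

Lemma measurable_bad_row h : measurable (bad_row h).
Proof. exact: measurable_itv_preimage (measurable_row_sqr _). Qed.

Let l2norm0 k : l2norm (0 : 'rV[R]_k) = 0.
Proof. by apply/eqP; rewrite l2norm_eq0. Qed.

Lemma bad_column_le v : (Q (bad_column v) <= (2 * expR (- (4 * p%:R)))%:E)%E.
Proof.
(* The tail bound needs positive variance; for [v = 0] all three quantities vanish and the bad event
   is empty. *)
have [->|v0] := eqVneq v 0.
  rewrite (_ : bad_column 0 = set0); first by rewrite measure0 lee_fin mulr_ge0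
      ?expR_ge0.
  apply/seteqP; split=> t //=.
  by move=> /negP []; rewrite mul0mx !l2norm0 expr0n/= !mulr0 !mul0r lexx.
apply: chi2_tails; first exact: measurable_column_sqr.
  by rewrite exprn_gt0// lt_neqAle eq_sym l2norm_eq0 v0 l2norm_ge0.
move=> l; rewrite l2norm_sqr => l0.
have := columns_laplace (fun=> 0) imu iQ l0.
rewrite [in X in _ = X](_ : \sum_(j < p) 0 ^+ 2 = 0); last first.
  by rewrite big1// => j _; rewrite expr0n.
rewrite mulr0 expR0 mulr1 => <-.
apply: eq_integral => t _; rewrite column_sqrE.
by congr (expR (_ * _))%:E; apply: eq_bigr => j _; rewrite add0r.
Qed.

Lemma bad_row_le h : (Q (bad_row h) <= (2 * expR (- (4 * n%:R)))%:E)%E.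
Proof.
have [->|h0] := eqVneq h 0.
  rewrite (_ : bad_row 0 = set0); first by rewrite measure0 lee_fin mulr_ge0
      ?expR_ge0.
  apply/seteqP; split=> t //=.
  by move=> /negP []; rewrite mul0mx !l2norm0 expr0n/= !mulr0 !mul0r lexx.
apply: chi2_tails; first exact: measurable_row_sqr.
  by rewrite exprn_gt0// lt_neqAle eq_sym l2norm_eq0 h0 l2norm_ge0.
move=> l; rewrite l2norm_sqr => l0.
rewrite -(rows_laplace imu iQ l0); apply: eq_integral => t _.
by rewrite row_sqrE.
Qed.

End gaussian_matrix.

(** * Absolute constants *)

Section constants.
Variable R : realType.

(* [net_scale] is what [seminorm_net] needs for [c = chi_lo_root] and [A = 5];
   [net_entropy] is then the logarithm of the number of grid points per dimension
   given by [card_grid]. *)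
Definition chi_lo_root : R := Num.sqrt chi_lo.
Definition net_scale : nat := (Num.trunc (60 / chi_lo_root)).+2.
Definition net_entropy : R := ln (2 ^ (net_scale ^ 2) * 3)%:R.
(** Chosen at least [net_entropy + 1]: in subspaces of dimension at most [n / block_ratio], the grid
    points and the choice of groups together contribute at most [n] to the exponent. *)
Definition block_ratio : nat := (Num.trunc net_entropy).+2.
Definition lower_slope : R := chi_lo_root / 4.
(** The 16 bounds [lower_slope + 15]; the 2 pays for the integer division in the number of groups
    per block. *)
Definition lower_defect : R := 16 * Num.sqrt (2 * block_ratio%:R).

Lemma chi_lo_root_gt0 : 0 < chi_lo_root.
Proof. by rewrite sqrtr_gt0 expR_gt0. Qed.

Lemma chi_lo_root_le1 : chi_lo_root <= 1.
Proof.
rewrite -[leRHS]sqrtr1 ler_sqrt// /chi_lo -[leRHS]expR0 ler_expR.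
by rewrite oppr_le0.
Qed.

Lemma lower_slope_gt0 : 0 < lower_slope.
Proof. by rewrite divr_gt0 ?chi_lo_root_gt0. Qed.

Lemma lower_defect_gt0 : 0 < lower_defect.
Proof. by rewrite mulr_gt0// sqrtr_gt0 mulr_gt0. Qed.

Lemma net_entropy_ge0 : 0 <= net_entropy.
Proof.
by rewrite ln_ge0// (ler_nat R 1) muln_gt0 expn_gt0.
Qed.

Lemma net_entropy_block : net_entropy + 1 <= block_ratio%:R.
Proof.
have /andP[_ H] := truncn_itv net_entropy_ge0.
by rewrite /block_ratio -natr1 lerD2r ltW.
Qed.

End constants.
Arguments net_scale R : clear implicits.
Arguments block_ratio R : clear implicits.
Arguments net_entropy R : clear implicits.
Arguments chi_lo_root R : clear implicits.
Arguments lower_slope R : clear implicits.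
Arguments lower_defect R : clear implicits.

Section nets.
Context {R : realType}.
Local Notation L := (net_scale R).
Local Notation c0 := (chi_lo_root R).

(** [seminorm_net] after taking square roots: the upper constant is [5 = sqrt chi_hi], whence
    [15 = 3 * 5], and the scale condition reads [60 = 12 * 5 <= c0 * L]. *)
Lemma chi2_net (q m d : nat) (N : 'rV[R]_q -> R) (S : {set 'I_q}) :
  (forall u v, N (u + v) <= N u + N v) -> (forall a u, N (a *: u) = `|a| * N u) ->
  (0 < m)%N -> (0 < d)%N -> (#|S| <= d)%N ->
  (forall z : {ffun 'I_q -> 'I_(2 * (L ^ 2 * d)).+1}, z \in grid S (L ^ 2 * d) ->
    chi_lo * l2norm (grid_vec z : 'rV[R]_q) ^+ 2 * m%:R <= N (grid_vec z) ^+ 2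
      <= chi_hi * l2norm (grid_vec z : 'rV[R]_q) ^+ 2 * m%:R) ->
  forall u : 'rV[R]_q, (forall j, j \notin S -> u ord0 j = 0) ->
    lower_slope R * Num.sqrt m%:R * l2norm u <= N u <=
        15 * Num.sqrt m%:R * l2norm u.
Proof.
move=> ND NZ m0 d0 Sd net u uS.
have sm0 : 0 < Num.sqrt m%:R :> R by rewrite sqrtr_gt0 ltr0n.
have cc0 := chi_lo_root_gt0 R.
have c02 : c0 ^+ 2 = chi_lo by rewrite sqr_sqrtr ?expR_ge0.
have sm2 : Num.sqrt m%:R ^+ 2 = m%:R :> R by rewrite sqr_sqrtr.
have := @seminorm_net R q N ND NZ S d L (c0 * Num.sqrt m%:R) (5 * Num.sqrt m%:R)
  d0 Sd isT _ _ _ _ u uS.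
have -> : 3 * (5 * Num.sqrt m%:R) = 15 * Num.sqrt m%:R :> R by ring.
have -> : c0 * Num.sqrt m%:R / 4 = lower_slope R * Num.sqrt m%:R.
  by rewrite /lower_slope mulrAC.
apply.
- by rewrite mulr_gt0.
- by rewrite mulr_ge0 ?ltW.
- have := truncn_itv (x :=
    60 / c0); rewrite divr_ge0 ?(ltW cc0)// => /(_ isT) /andP[_ H].
  rewrite mulrA [leRHS]mulrAC ler_pM2r//.
  have : 60 <= c0 * L%:R.
    rewrite mulrC -ler_pdivrMr// (le_trans (ltW H))// ler_nat.
    exact: leqnSn.
  by apply: le_trans; lra.
- move=> z zG; have /andP[lo hi] := net z zG.
  have Nz0 := seminorm_ge0 ND NZ (grid_vec z).
  apply/andP; split; rewrite -(@ler_pXn2r _ 2)//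
    ?nnegrE ?mulr_ge0 ?l2norm_ge0 ?sqrtr_ge0//.
  + by rewrite 2!exprMn c02 sm2 mulrAC.
  + by rewrite 2!exprMn sm2 mulrAC (_ : 5 ^+ 2 = chi_hi)// /chi_hi; ring.
Qed.

Lemma card_grid_expR q (S : {set 'I_q}) (d : nat) (x : R) : (#|S| <= d)%N ->
  #|grid S (L ^ 2 * d)|%:R * (2 * expR x) <= expR (d%:R * net_entropy R + 1 + x).
Proof.
move=> Sd; rewrite !expRD -mulrA.
have H2 : 2 <= expR 1 :> R by apply: le_trans (expR_ge1Dx _); lra.
have H : #|grid S (L ^ 2 * d)|%:R <= expR (d%:R * net_entropy R) :> R.
  rewrite expRM_natl lnK ?posrE; last by rewrite ltr0n muln_gt0 expn_gt0.
  rewrite -natrX ler_nat (leq_trans (card_grid S _ (R := R)))//.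
  by rewrite expnM expnMn -expnM leq_mul2l leq_pexp2l ?orbT.
by apply: ler_pM => //; rewrite ler_pM2r// expR_gt0.
Qed.

End nets.

(** * The good event for the design matrix *)

Section gaussian_design.
Context {R : realType} {n p M : nat} (G : 'I_M -> {set 'I_p}).
Hypotheses (n0 : (0 < n)%N) (M0 : (0 < M)%N) (partG : group_partition G).
Variables (mu : probability (p.-tuple R) R)
  (Q : probability (n.-tuple (p.-tuple R)) R).
Hypotheses (imu : iid (gauss R) mu) (iQ : iid mu Q).
Hypothesis p_large : n%:R * (net_entropy R + 1) <= p%:R.
Hypothesis M_small : ln M%:R <= (min_group G)%:R :> R.

Local Notation L := (net_scale R).
Local Notation b := (max_group G).
Local Notation D := (block_ratio R).

Let bad_columns : set (n.-tuple (p.-tuple R)) :=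
  \big[setU/set0]_(z in grid [set: 'I_n] (L ^ 2 * n)) bad_column (grid_vec z).

Let bad_columns_le : measurable bad_columns /\
  (Q bad_columns <= (expR (- (2 * n%:R)))%:E)%E.
Proof.
have [mU QU] := finite_union_bound (grid [set: 'I_n] (L ^ 2 * n))
  (fun z => measurable_bad_column (grid_vec z))
  (fun z => bad_column_le imu iQ (grid_vec z)).
split=> //; apply: le_trans QU _; rewrite lee_fin.
apply: le_trans (card_grid_expR _ _) _; first by rewrite cardsT card_ord.
have n1 : 1 <= n%:R :> R by rewrite ler1n.
have e0 := net_entropy_ge0 R.
have : 0 <= n%:R * net_entropy R by rewrite mulr_ge0.
by rewrite ler_expR; move: p_large; rewrite mulrDr; lra.
Qed.

Let block_size : nat := (n %/ (b * D))%N.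

(** Choices of groups are encoded as functions, repetitions allowed, so that their number is exactly
    [M ^ block_size]. *)
Let groups_of (f : {ffun 'I_block_size -> 'I_M}) : {set 'I_p} :=
  group_union G (f @: [set: 'I_block_size])%SET.

Let bad_rows : set (n.-tuple (p.-tuple R)) :=
  \big[setU/set0]_(f in [set: {ffun 'I_block_size -> 'I_M}]%SET)
    \big[setU/set0]_(z in grid (groups_of f) (L ^ 2 * (block_size * b)))
      bad_row (grid_vec z).

Let card_group_union (T : {set 'I_M}) : (#|group_union G T| <= #|T| * b)%N.
Proof.
apply: (@leq_trans (\sum_(i in T) #|G i|)%N).
  rewrite -(ler_nat R) natr_sum -sum1_card natr_sum big_mkcond.
  rewrite (sum_over_groups partG) [leRHS]big_mkcond; apply: ler_sum => i _.
  rewrite (eq_bigr (fun=> (i \in T)%:R)); last first.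
    by move=> j jG; rewrite (in_group_union partG _ jG); case: (i \in T).
  by case: (i \in T); rewrite sumr_const ?mul0rn.
rewrite -sum_nat_const; apply: leq_sum => i _; exact: max_group_ge.
Qed.

Let card_groups_of f : (#|groups_of f| <= block_size * b)%N.
Proof.
apply: leq_trans (card_group_union _) _; rewrite leq_mul2r.
by rewrite (leq_trans (leq_imset_card _ _)) ?orbT// cardsT card_ord.
Qed.

Let bad_rows_le : measurable bad_rows /\
  (Q bad_rows <= (expR (- (2 * n%:R)))%:E)%E.
Proof.
pose e : R := expR ((block_size * b)%:R * net_entropy R + 1 + - (4 * n%:R)).
have inner f := finite_union_bound (grid (groups_of f) (L ^ 2 * (block_size * b)))
  (fun z => measurable_bad_row (grid_vec z))
  (fun z => bad_row_le imu iQ (grid_vec z)).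
have inner_le f : (Q (\big[setU/set0]_(z in grid (groups_of f) (L ^ 2 *
    (block_size * b)))
    bad_row (grid_vec z)) <= e%:E)%E.
  apply: le_trans (inner f).2 _; rewrite lee_fin.
  exact: card_grid_expR.
have [mU QU] := finite_union_bound [set: {ffun 'I_block_size -> 'I_M}]%SET
  (fun f => (inner f).1) inner_le.
split=> //; apply: le_trans QU _; rewrite lee_fin /e.
rewrite cardsT card_ffun !card_ord natrX.
have -> : M%:R ^+ block_size = expR (block_size%:R * ln M%:R) :> R.
  by rewrite expRM_natl lnK// posrE ltr0n.
rewrite -expRD ler_expR.
have n1 : 1 <= n%:R :> R by rewrite ler1n.
have kbD : (block_size * b)%:R * D%:R <= n%:R :> R.
  by rewrite -natrM ler_nat -mulnA leq_divM.
have kb0 : 0 <= (block_size * b)%:R :> R by [].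
(* The assumption on [ln M] enters here: choosing the groups costs no more than one unit of entropy
   per dimension. *)
have H1 : block_size%:R * ln M%:R <= (block_size * b)%:R :> R.
  rewrite natrM ler_wpM2l// (le_trans M_small)// ler_nat.
  exact: min_group_le_max.
have H2 := ler_wpM2l kb0 (net_entropy_block R).
by move: H2; rewrite mulrDr; lra.
Qed.

Definition good_design : set (n.-tuple (p.-tuple R)) :=
  (~` (bad_columns `|` bad_rows))%classic.

Lemma measurable_good_design : measurable good_design.
Proof.
by apply: measurableC; apply: measurableU; [exact: bad_columns_le.1|exact:
    bad_rows_le.1].
Qed.

(** Each bad event has probability at most [e^(-2n)], and [2 e^(-2n) <= e^(-n)] because
    [e^n >= 1 + n >= 2]. *)
Lemma good_design_ge : ((1 - M%:R * expR (- n%:R))%:E <= Q good_design)%E.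
Proof.
have [mc Qc] := bad_columns_le; have [mr Qr] := bad_rows_le.
have mU : measurable (bad_columns `|` bad_rows)%classic by exact: measurableU.
rewrite /good_design probability_setC// EFinB leeB//.
apply: le_trans (measureU2 _ mc mr) _.
apply: le_trans (leeD Qc Qr) _; rewrite -EFinD lee_fin.
have n1 : 1 <= n%:R :> R by rewrite ler1n.
have M1 : 1 <= M%:R :> R by rewrite ler1n.
have -> : - (2 * n%:R) = - n%:R + - n%:R :> R by ring.
rewrite expRD; have e0 := expR_gt0 (- n%:R : R).
have : expR (- n%:R) * 2 <= 1 :> R.
  rewrite expRN mulrC ler_pdivrMr ?expR_gt0// mul1r.
  by apply: le_trans (expR_ge1Dx _); lra.
by nra.
Qed.

Lemma good_design_columns t : good_design t -> forall v : 'rV[R]_n,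
  lower_slope R * Num.sqrt p%:R * l2norm v <= l2norm (v *m matrix_of t).
Proof.
move=> gt v.
have p0 : (0 < p)%N.
  case: partG => Gpos _ _; apply: leq_trans (Gpos (Ordinal M0)) _.
  by rewrite -[leqRHS]card_ord max_card.
suff /andP[] : lower_slope R * Num.sqrt p%:R * l2norm v <= l2norm (v *m matrix_of t)
    <= 15 * Num.sqrt p%:R * l2norm v by [].
apply: (@chi2_net R n p n (fun v => l2norm (v *m matrix_of t)) [set:
    'I_n]%SET) => //.
- by move=> u w; rewrite mulmxDl l2normD.
- by move=> a u; rewrite -scalemxAl l2normZ.
- by rewrite cardsT card_ord.
- move=> z zG; apply/negPn/negP => bad; apply: gt; left.
  rewrite /bad_columns -bigcup_seq_cond; exists z => //=.
  by rewrite mem_index_enum.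
- by move=> j; rewrite finset.in_setT.
Qed.

Lemma good_design_rows t (T : {set 'I_M}) (u : 'rV[R]_p) : good_design t ->
  (0 < block_size)%N -> (#|T| <= block_size)%N ->
  (forall j, j \notin group_union G T -> u ord0 j = 0) ->
  lower_slope R * Num.sqrt n%:R * l2norm u <= l2norm (u *m (matrix_of t)^T)
    <= 15 * Num.sqrt n%:R * l2norm u.
Proof.
move=> gt k0 Tk uT.
have b0 : (0 < b)%N by rewrite (leq_trans (min_group_gt0 partG M0))
    ?min_group_le_max.
pose i0 : 'I_M := Ordinal M0.
(* Indices beyond the size of [T] receive the default group [i0]; the image may thus be larger than
   [T], which is harmless for a support condition. *)
pose f : {ffun 'I_block_size -> 'I_M} := [ffun i : 'I__ => nth i0 (enum T) i].
have Tf : T \subset (f @: [set: 'I_block_size])%SET.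
  apply/fintype.subsetP => i iT.
  have ik : (index i (enum T) < block_size)%N.
    by rewrite (leq_trans _ Tk)// cardE index_mem mem_enum.
  apply/imsetP; exists (Ordinal ik); first by rewrite finset.in_setT.
  by rewrite ffunE/= nth_index// mem_enum.
have := @chi2_net R p n (block_size * b) (fun v => l2norm (v *m (matrix_of t)^T))
  (groups_of f).
apply=> //.
- by move=> v w; rewrite mulmxDl l2normD.
- by move=> a v; rewrite -scalemxAl l2normZ.
- by rewrite muln_gt0 k0.
- move=> z zG; apply/negPn/negP => bad; apply: gt; right.
  rewrite /bad_rows -bigcup_seq_cond; exists f => /=.
    by rewrite mem_index_enum finset.in_setT.
  by rewrite -bigcup_seq_cond; exists z => //=; rewrite mem_index_enum.
- move=> j jf; apply: uT; apply: contra jf; rewrite !inE.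
  move=> /existsP[i /andP[iT jG]]; apply/existsP; exists i.
  by rewrite jG andbT (fintype.subsetP Tf).
Qed.

Lemma good_design_lower t : good_design t -> forall h : 'rV[R]_p,
  lower_slope R * Num.sqrt n%:R * l2norm h <= l2norm (h *m (matrix_of t)^T) +
    lower_defect R * Num.sqrt b%:R * gl_norm G h.
Proof.
move=> gt h.
have b0 : (0 < b)%N by rewrite (leq_trans (min_group_gt0 partG M0))
    ?min_group_le_max.
have sn0 : 0 < Num.sqrt n%:R :> R by rewrite sqrtr_gt0 ltr0n.
have D0 : (0 < D)%N by [].
have gl0 : 0 <= gl_norm G h by exact: gl_norm_ge0.
have cle : lower_slope R <= 1.
  by rewrite /lower_slope ler_pdivrMr// mul1r (le_trans (chi_lo_root_le1 R))//
      ler1n.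
have c_gt0 := lower_slope_gt0 R.
have dE : lower_defect R * Num.sqrt b%:R = 16 * Num.sqrt (2 * D%:R * b%:R).
  by rewrite (sqrtrM b%:R) ?mulr_ge0// mulrA.
(* If no group fits into a block then [n < b * D], and the defect term alone dominates since the
   Euclidean norm is at most the group norm. *)
have [k0|] := posnP block_size.
  have nbD : (n < b * D)%N.
    by move/eqP: k0; rewrite /block_size -leqn0 -ltnS ltn_divLR ?muln_gt0 ?b0//
        mul1n.
  have H : lower_slope R * Num.sqrt n%:R * l2norm h <=
      lower_defect R * Num.sqrt b%:R * gl_norm G h.
    rewrite dE; apply: ler_pM => //; rewrite ?l2norm_ge0//.
    - by rewrite mulr_ge0 ?sqrtr_ge0 ?ltW.
    - apply: ler_pM; rewrite ?sqrtr_ge0 ?(ltW c_gt0)//.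
        by rewrite (le_trans cle)// ler1n.
      rewrite ler_sqrt; last by rewrite !mulr_ge0.
      rewrite -!natrM ler_nat (leq_trans (ltnW nbD))//.
      by rewrite mulnC -mulnA leq_pmull.
    - exact: l2norm_le_gl_norm.
  by rewrite (le_trans H)// lerDr l2norm_ge0.
move=> k0.
have sk0 : 0 < Num.sqrt block_size%:R :> R by rewrite sqrtr_gt0 ltr0n.
have := @seminorm_group_lower R p M G partG (fun v => l2norm (v *m (matrix_of t)^T))
  (lower_slope R * Num.sqrt n%:R) (15 * Num.sqrt n%:R) block_size.
move=> /(_ _ _ _ _ k0 _ h) H.
apply: le_trans (H _ _ _ _ _) _.
- by move=> v w; rewrite mulmxDl l2normD.
- by move=> a v; rewrite -scalemxAl l2normZ.
- by rewrite mulr_gt0.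
- by rewrite mulr_ge0// ltW.
- by move=> T u Tk uT; exact: (good_design_rows gt k0 Tk uT).
rewrite lerD2l.
have -> : (lower_slope R * Num.sqrt n%:R + 15 * Num.sqrt n%:R) *
    (gl_norm G h / Num.sqrt block_size%:R) =
    (lower_slope R + 15) * (Num.sqrt n%:R / Num.sqrt block_size%:R) * gl_norm G h.
  by ring.
rewrite ler_wpM2r// dE; apply: ler_pM.
- by rewrite addr_ge0// ltW.
- by rewrite divr_ge0 ?sqrtr_ge0.
- by move: cle; lra.
rewrite ler_pdivrMr// -sqrtrM; last by rewrite !mulr_ge0.
rewrite ler_sqrt; last by rewrite !mulr_ge0.
rewrite -!natrM ler_nat ltnW//.
rewrite (_ : 2 * D * b * block_size = (block_size + block_size) * (b * D))%N;
    last by ring.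
(* Euclidean division gives [n < (block_size + 1) * (b * D)], and [block_size + 1 <= 2 * block_size]
   as [block_size] is positive. *)
apply: (@leq_trans (block_size.+1 * (b * D))).
  by rewrite -ltn_divLR ?muln_gt0 ?b0.
by rewrite leq_mul2r -addn1 leq_add2l k0 orbT.
Qed.

End gaussian_design.

(** * From the good event to the recovery bounds *)

Lemma inner_matrix_of (R : realType) n p (t : n.-tuple (p.-tuple R))
    (h : 'rV[R]_p) i : inner (tnth t i) h = (h *m (matrix_of t)^T) ord0 i.
Proof. by rewrite /inner mxE; apply: eq_bigr => j _; rewrite !mxE mulrC. Qed.

Theorem theorem3p3 (R : realType) :
  exists C c1 c2 c3 c4 : R,
    [/\ 0 < C, 0 < c1, 0 < c2, 0 < c3 & 0 < c4] /\
    forall (n p M s : nat) (G : 'I_M -> {set 'I_p})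
      (d : measure_display) (T : measurableType d) (P : probability T R)
      (X : 'I_n -> {RV P >-> p.-tuple R})
      (hstar : 'rV[R]_p) (xi Y : T -> 'rV[R]_n),
    (0 < n)%N -> (0 < M)%N ->
    group_partition G ->
    mutually_independent X ->
    (forall i, std_gaussian (X i)) ->
    group_sparse G s hstar ->
    (forall w i, Y w ord0 i = inner (X i w) hstar + xi w ord0 i) ->
    c1 * n%:R * ln (n%:R + group_ratio R G) <= p%:R ->
    ln M%:R <= c2 * (min_group G)%:R ->
    exists A : set T,
      [/\ measurable A,
          ((1 - M%:R * expR (- (c3 * n%:R)))%:E <= P A)%E
        & forall w, A w ->
          forall hhat : 'rV[R]_p,
          min_gl_interpolator G (fun i => X i w) (Y w) hhat ->
          l2norm (hhat - hstar) ^+ 2 <=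
            C * (group_ratio R G * (l2norm (xi w) ^+ 2 / n%:R)
                 + gl_norm G hstar ^+ 2 * ((max_group G)%:R / n%:R))
          /\
          ((s * max_group G)%:R <= c4 * n%:R ->
           l2norm (hhat - hstar) ^+ 2 <=
             C * group_ratio R G * (l2norm (xi w) ^+ 2 / n%:R))].
Proof.
pose kappa := lower_slope R; pose Lambda := lower_defect R.
have k0 : 0 < kappa := lower_slope_gt0 R.
have L0 : 0 < Lambda := lower_defect_gt0 R.
have ln2 : 0 < ln 2 :> R by rewrite ln_gt0// ltr1n.
have e0 := net_entropy_ge0 R.
(* [C] and [c4] are the constants of the recovery lemmas with [c = kappa]. In [c1] the division by
   [ln 2] works because [n + W >= 2], so that the hypothesis on [p] gives
   [p >= n * (net_entropy + 1)]. *)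
exists ((4 * (1 + Lambda / kappa) ^+ 2 + 8 * Lambda ^+ 2) / kappa ^+ 2),
  ((net_entropy R + 1) / ln 2), 1, 1, (kappa ^+ 2 / (16 * Lambda ^+ 2)).
have k2 : 0 < kappa ^+ 2 by exact: exprn_gt0.
have L2 : 0 < Lambda ^+ 2 by exact: exprn_gt0.
split.
  split=> //; last by apply: divr_gt0 => //; apply: mulr_gt0.
    apply: divr_gt0 => //; apply: ltr_wpDl; last by apply: mulr_gt0.
    by apply: mulr_ge0 => //; exact: sqr_ge0.
  by apply: divr_gt0 => //; apply: ltr_wpDl.
move=> n p M s G d T P X hstar xi Y n0 M0 partG indep gaussX sparse Ydef plarge
    Msmall.
have W1 : 1 <= group_ratio R G.
  rewrite /group_ratio ler_pdivlMr ?ltr0n ?min_group_gt0// mul1r ler_nat.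
  exact: min_group_le_max.
have n1 : 1 <= n%:R :> R by rewrite ler1n.
have p_large : n%:R * (net_entropy R + 1) <= p%:R.
  apply: le_trans plarge.
  have -> : n%:R * (net_entropy R + 1) = (net_entropy R + 1) / ln 2 * n%:R * ln 2.
    by field; rewrite gt_eqF.
  rewrite ler_wpM2l ?mulr_ge0 ?invr_ge0 ?(ltW ln2)//; first by rewrite addr_ge0.
  by rewrite ler_ln ?posrE//; lra.
rewrite mul1r in Msmall.
have iQ := iid_design indep gaussX (Ordinal n0).
have imu := iid_row gaussX (Ordinal n0).
pose A := good_design (R := R) (n := n) G.
(* The event depends on the design only; the bounds on it hold for every [xi w], so the noise may
   depend on the design in any way. *)
exists (design_tuple X @^-1` A)%classic; split.
- rewrite -[X in measurable X]setTI.
  by apply: (measurable_funP (design_tuple X)) => //;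
      exact: measurable_good_design imu iQ _ _.
- rewrite mul1r; exact: (good_design_ge n0 M0 partG imu iQ p_large Msmall).
move=> w Aw hhat [fit hmin].
pose t := design_tuple X w.
have rowE h i : inner (X i w) h = (h *m (matrix_of t)^T) ord0 i.
  by rewrite -inner_matrix_of tnth_mktuple.
have fitE h : interpolates (fun i => X i w) (Y w) h <->
    h *m (matrix_of t)^T = hstar *m (matrix_of t)^T + xi w.
  split=> [H|H i].
    by apply/rowP => i; rewrite -rowE H Ydef mxE rowE.
  by rewrite rowE H Ydef mxE rowE.
have smin := good_design_columns n0 M0 partG Aw.
have lower := good_design_lower n0 M0 partG Aw.
have hfit := (fitE hhat).1 fit.
have hmin' h : h *m (matrix_of t)^T = hstar *m (matrix_of t)^T + xi w ->
    gl_norm G hhat <= gl_norm G h by move/fitE; exact: hmin.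
split.
  exact: (recovery_general n0 M0 partG k0 L0 k0 smin lower hfit hmin').
exact: (recovery_sparse n0 M0 partG k0 L0 k0 smin lower sparse hfit hmin').
Qed.
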